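(* Let $0<a<b$ and $P\in\mathcal C^2_\psi(\Omega)$ with $a\le P(\omega)\le b$ for all $\omega\in\Omega$. For $\omega\in\Omega$ let $p_\omega(t)=P(\omega+\psi(t))$, $t\in\mathbb R$, and let $v_*=2\max\{\max_{\varpi\in\Omega}\partial_\psi P(\varpi),0\}$. Let $E_\omega$ be the escaping set of the ping-pong map with forcing $p=p_\omega$, i.e. the set of $(t_0,v_0)\in\mathbb R\times(v_*,\infty)$ for which the whole forward orbit $(t_n,v_n)_{n\in\mathbb N}$ is well defined (all $v_n>v_*$) and $\lim_{n\to\infty}v_n=\infty$. Then for $\mu_\Omega$-almost every $\omega\in\Omega$ the set $E_\omega\subset\mathbb R^2$ has Lebesgue measure zero.
   Context: $\Omega$ is a commutative (written additively), compact, metrizable topological group, and $\psi:\mathbb R\to\Omega$ is a continuous group homomorphism with $\psi(\mathbb R)$ dense; $\mu_\Omega$ is its Haar probability measure. For $U:\Omega\to\mathbb R$, $\partial_\psi U(\omega)=\lim_{t\to0}\frac{U(\omega+\psi(t))-U(\omega)}{t}$; $\mathcal C^2_\psi(\Omega)$ is the space of continuous $U$ such that $\partial_\psi U$ and $\partial_\psi^2U=\partial_\psi(\partial_\psi U)$ exist everywhere and are continuous on $\Omega$. Ping-pong map: for a forcing $p\in\mathcal C^2(\mathbb R)$ with $0<a\le p\le b$ and bounded $\dot p,\ddot p$, and $v_0>v_*:=2\max\{\sup_t\dot p(t),0\}$, the map $(t_0,v_0)\mapsto(t_1,v_1)$ is defined by letting $\tilde t$ be the unique solution of $(\tilde t-t_0)v_0=p(\tilde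 t)$ and setting $v_1=v_0-2\dot p(\tilde t)$, $t_1=\tilde t+p(\tilde t)/v_1$. (It describes a particle bouncing elastically between a fixed wall at $x=0$ and a moving wall at $x=p(t)$; $t_n,v_n$ are the times and post-impact velocities of successive impacts at $x=0$.) Orbits are $(t_n,v_n)$ obtained by iterating this map as long as $v_n>v_*$. *)

(* Defs.v *)
From HB Require Import structures.
From mathcomp Require Import all_boot all_order all_algebra.
From mathcomp Require Import all_classical all_reals all_analysis.
Set Implicit Arguments. Unset Strict Implicit. Unset Printing Implicit Defensive.
Import Order.TTheory GRing.Theory Num.Theory.
Import numFieldNormedType.Exports.
Local Open Scope classical_set_scope.
Local Open Scope ring_scope.

Definition metrizable (R : realType) (T : topologicalType) : Prop :=
  exists d : T -> T -> R,
    [/\ (forall x y, 0 <= d x y),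
        (forall x y, d x y = 0 <-> x = y),
        (forall x y, d x y = d y x),
        (forall x y z, d x z <= d x y + d y z) &
        (forall A : set T, open A <->
           (forall x, A x -> exists2 e : R, 0 < e & [set y | d x y < e] `<=` A))].

Definition ptT (Om : topologicalZmodType) : Type := Om.
HB.instance Definition _ (Om : topologicalZmodType) := Topological.on (ptT Om).
HB.instance Definition _ (Om : topologicalZmodType) := isPointed.Build (ptT Om) (0 : Om).
Notation borel_type Om := (g_sigma_algebraType (@open (ptT Om))).

Definition haar_probability (R : realType) (Om : topologicalZmodType)
  (mu : set (borel_type Om) -> \bar R) : Prop :=
  mu setT = 1%E /\
  forall (x : Om) (A : set Om),
    measurable (A : set (borel_type Om)) ->
    mu ([set y + x | y in A] : set (borel_type Om)) = mu A.

Definition dquot (R : realType) (Om : topologicalZmodType) (psi : R -> Om)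
  (U : Om -> R) (w : Om) : R -> R :=
  fun t => (U (w + psi t) - U w) / t.

Definition has_dpsi (R : realType) (Om : topologicalZmodType) (psi : R -> Om)
  (U : Om -> R) (w : Om) : Prop :=
  exists l : R, dquot psi U w t @[t --> 0^'] --> l.

Definition dpsi (R : realType) (Om : topologicalZmodType) (psi : R -> Om)
  (U : Om -> R) (w : Om) : R :=
  lim (dquot psi U w t @[t --> 0^']).

Definition C2psi (R : realType) (Om : topologicalZmodType) (psi : R -> Om)
  (U : Om -> R) : Prop :=
  [/\ continuous U,
      (forall w, has_dpsi psi U w),
      continuous (dpsi psi U),
      (forall w, has_dpsi psi (dpsi psi U) w) &
      continuous (dpsi psi (dpsi psi U))].

(* Ping-pong map with forcing p: tilde t is the (unique, when v0 > v_* ) solution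
   of (tt - t0) v0 = p tt; v1 = v0 - 2 p'(tt); t1 = tt + p(tt)/v1. *)
Definition pp_tilde (R : realType) (p : R -> R) (t0 v0 : R) : R :=
  xget 0 [set tt | (tt - t0) * v0 = p tt].

Definition pp_map (R : realType) (p : R -> R) (z : R * R) : R * R :=
  let tt := pp_tilde p z.1 z.2 in
  let v1 := z.2 - 2 * derive1 p tt in
  (tt + p tt / v1, v1).

Definition pp_orbit (R : realType) (p : R -> R) (z : R * R) (n : nat) : R * R :=
  iter n (pp_map p) z.

Definition escaping_set (R : realType) (p : R -> R) (vstar : R) : set (R * R) :=
  [set z | (forall n, vstar < (pp_orbit p z n).2) /\
           ((fun n => (pp_orbit p z n).2) @ \oo --> +oo)].

(* Main.v *)
Require Import Defs.
From HB Require Import structures.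
From mathcomp Require Import all_boot all_order all_algebra.
From mathcomp Require Import all_classical all_reals all_analysis.
From mathcomp Require Import measurable_realfun.
From mathcomp Require Import ring lra.
Import Order.TTheory GRing.Theory Num.Theory.
Import numFieldNormedType.Exports.
Local Open Scope classical_set_scope.
Local Open Scope ring_scope.
Set Implicit Arguments. Unset Strict Implicit. Unset Printing Implicit Defensive.

(** Lift the ping-pong map to the phase space [Om * R]: a state [(w, v)] stands
    for an impact on the fixed wall at time 0 with forcing [t |-> P (w + psi t)].
    The lifted map [bounce] is a composition of two time changes along the flow
    [w |-> w + psi t] and a shear in [v], so wherever the velocity is large it
    does not increase the measure [v dmu dv]; elsewhere it still pulls null sets
    back to null sets. The product [W = P w * v] is an adiabatic invariant: one
    bounce changes it by [o (1 / v)], hence the set of states that jump over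
    a level [W = c] has measure tending to 0 as [c] goes to infinity. For a
    fixed level [c], let [A] be the set of states below [c] whose whole forward
    orbit stays above it, and consider the states that stay above [c] forever
    and are currently below [c']. Mass enters this set through [A] and never
    leaves it through [c], so the mass of [A] is at most what crosses [c'] in
    one step, which is arbitrarily small. Thus [A] is null; every escaping orbit
    has a last passage below each high level, so the escaping states form a null
    subset of [Om * R], and Fubini along the flow gives the statement for almost
    every [w]. *)

(** * Measurability and integration *)

(* Second countability of [R] alone suffices: for each rational ball of [R]
   take the largest open set of [Om] whose product with it lies in [U]. *)
Lemma open_prod_measurable (R : realType) (Om : topologicalZmodType)
    (U : set (Om * R)) :
  open U -> measurable (U : set (borel_type Om * R)).
Proof.
move=> oU.
pose V (q : rat * rat) : set Om :=
  interior [set w | forall s, ball (ratr q.1 : R) (ratr q.2) s -> U (w, s)].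
have -> : (U : set (borel_type Om * R)) =
    \bigcup_q ((V q : set (borel_type Om)) `*` ball (ratr q.1 : R) (ratr q.2)).
  apply/seteqP; split => [[w s] Uws|[w s] [q _ [/= Vw qs]]]; last first.
    by move: (nbhs_singleton Vw) => /(_ _ qs).
  have [[A B] /= [nA nB] ABU] : nbhs (w, s) U by exact: open_nbhs_nbhs.
  have sB : s \in (interior B : set R) by rewrite inE; exact: nB.
  have [c [r [/set_mem sr rB]]] := open_subball_rat (open_interior B) sB.
  exists (c, r) => //; split => //=.
  apply: filterS nA => x Ax y /rB/interior_subset By.
  by apply: ABU.
apply: countable_bigcupT_measurable => [|q]; first exact: countableP.
apply: measurableX; last by apply: measurable_ball.
by apply: sub_sigma_algebra; exact: open_interior.
Qed.

Lemma continuous_borel_measurable_fun (R : realType)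
    (Om : topologicalZmodType) (f : Om -> R) :
  continuous f -> measurable_fun setT (f : borel_type Om -> R).
Proof.
move=> /continuousP cf; apply: (measurability _ (RGenOpens.measurableE R)).
move=> _ [_ [a [b ->] <-]]; rewrite setTI.
by apply: sub_sigma_algebra; exact/cf/interval_open.
Qed.

Lemma continuous_prod_measurable_fun (R : realType) (Om : topologicalZmodType)
    (f : Om * R -> Om) :
  continuous f -> measurable_fun setT (f : borel_type Om * R -> borel_type Om).
Proof.
move=> /continuousP cf; apply: measurability; first by [].
by move=> _ [B oB <-]; rewrite setTI; apply: open_prod_measurable; exact: cf.
Qed.

Lemma measurable_fun_inv (R : realType) :
  measurable_fun [set: R] (fun u : R => u^-1).
Proof.
rewrite -(setUv [set (0 : R)]); apply/measurable_funU => //.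
- exact: measurableC.
- split; first exact: measurable_fun_set1.
  apply: open_continuous_measurable_fun.
    by apply: closed_openC; exact: closed_eq.
  by move=> x /set_mem /= /eqP x0; exact: inv_continuous.
Qed.

(** * Change of variables on the line *)

Section substitution.
Context {R : realType}.
Variables (phi dphi : R -> R) (q r : R).
Hypotheses (qr : q < r) (dphiE : forall x : R, is_derive x 1 phi (dphi x)).
Hypothesis cdphi : continuous dphi.
Hypothesis dphi_gt0 : forall x, q <= x <= r -> 0 < dphi x.
Local Notation leb := (@lebesgue_measure R).

Let cphi : continuous phi.
Proof. by move=> x; apply/differentiable_continuous/derivable1_diffP. Qed.

Lemma derive_gt0_lt x y : q <= x -> y <= r -> x < y -> phi x < phi y.
Proof.
move=> qx yr xy.
have [|z zxy e] := @MVT R phi dphi x y xy (fun x _ => dphiE x).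
  exact/continuous_subspaceT.
rewrite -subr_gt0 e mulr_gt0 ?subr_gt0// dphi_gt0//.
move: zxy; rewrite in_itv/= => /andP[xz zy].
by rewrite (le_trans qx (ltW xz)) (le_trans (ltW zy) yr).
Qed.

Lemma derive_gt0_le x y : q <= x -> y <= r -> x <= y -> phi x <= phi y.
Proof.
by move=> qx yr; rewrite le_eqVlt => /predU1P[->//|/derive_gt0_lt]; move/(_ qx yr)/ltW.
Qed.

Let dens : R -> \bar R := (EFin \o dphi) \_ `]q, r].

Let mdens : measurable_fun setT dens.
Proof.
apply/(measurable_restrictT (EFin \o dphi) (measurable_itv _)).
apply/measurable_EFinP.
by apply: measurable_funTS; exact: continuous_measurable_fun.
Qed.

Let dens_ge0 x : (0 <= dens x)%E.
Proof.
rewrite /dens patchE; case: ifPn => //; rewrite inE/= in_itv/= => /andP[qx xr].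
by rewrite lee_fin ltW// dphi_gt0// xr ltW.
Qed.

Let mphi (A : set (measurableTypeR R)) :
  measurable A -> measurable (phi @^-1` A).
Proof.
by move=> mA; rewrite -[X in measurable X]setTI; apply: continuous_measurable_fun.
Qed.

(** The image under [phi] of the measure with density [dphi] on []q, r]]. Defining it on all Borel
    sets makes it a measure that can be compared with Lebesgue measure. *)
Let nu1 (A : set (measurableTypeR R)) : \bar R :=
  (\int[leb]_(x in phi @^-1` A) dens x)%E.
Let nu10 : nu1 set0 = 0%E. Proof. exact: integral_set0. Qed.
Let nu1_ge0 A : (0 <= nu1 A)%E. Proof. exact: integral_ge0. Qed.
Let nu1_sadd : semi_sigma_additive nu1.
Proof.
move=> F mF tF mUF; rewrite /nu1 preimage_bigcup.
apply: semi_sigma_additive_nng_induced => //.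
- by move=> n; exact: mphi.
- apply/trivIsetP => /= i j _ _ ij; rewrite -preimage_setI.
  by move/trivIsetP : tF => /(_ _ _ _ _ ij) ->//; rewrite preimage_set0.
- by rewrite -preimage_bigcup; exact: mphi.
Qed.
HB.instance Definition _ := isMeasure.Build _ _ _ nu1 nu10 nu1_ge0 nu1_sadd.

Let E : set (measurableTypeR R) := `]phi q, phi r]%classic.
Let mE : measurable E. Proof. exact: measurable_itv. Qed.

Let nu1E A : measurable A ->
  nu1 A = (\int[leb]_(x in `]q, r] `&` phi @^-1` A) (dphi x)%:E)%E.
Proof.
move=> mA; rewrite /nu1 /dens setIC [RHS]integral_mkcondr//.
Qed.

(** After truncation to [E], the endpoints have preimages by the intermediate value theorem.
    Monotonicity turns the preimage of the interval into the interval between them, where the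
    fundamental theorem of calculus applies. *)
Let nu1_itv x y : nu1 `]x, y]%classic = leb (`]x, y] `&` E)%classic.
Proof.
have pqr : phi q < phi r by exact: derive_gt0_lt.
rewrite nu1E; last exact: measurable_itv.
have -> : (`]x, y] `&` E = `]Num.max x (phi q), Num.min y (phi r)])%classic.
  apply/seteqP; split => z; rewrite /E/= !in_itv/= gt_max le_min.
    by move=> [/andP[-> ->] /andP[-> ->]].
  by move=> /andP[/andP[-> ->] /andP[-> ->]].
set x1 := Num.max _ _; set y1 := Num.min _ _.
have [y1x1|x1y1] := leP y1 x1.
  have -> : `]x1, y1]%classic = set0.
    apply/seteqP; split => z//=; rewrite in_itv/= => /andP[/lt_le_trans h /h].
    by rewrite ltNge y1x1.
  rewrite measure0.
  rewrite [X in integral _ X _](_ : _ = set0) ?integral_set0//.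
  apply/seteqP; split => z //= []; rewrite !in_itv/= => /andP[qz zr] /andP[xz zy].
  have : x1 < phi z by rewrite gt_max xz derive_gt0_lt.
  have : phi z <= y1 by rewrite le_min zy derive_gt0_le// ltW.
  by move=> /le_trans/(_ y1x1)/le_lt_trans h /h; rewrite ltxx.
have IV z : phi q <= z <= phi r -> exists2 c, c \in `[q, r] & phi c = z.
  move=> zqr; apply: IVT; [exact: ltW|exact: continuous_subspaceT|].
  by rewrite min_l ?max_r// ltW.
have [|x' + x'E] := IV x1.
  by rewrite le_max lexx orbT/= (le_trans (ltW x1y1))// ge_min lexx orbT.
have [|y' + y'E] := IV y1.
  by rewrite ge_min lexx orbT andbT (le_trans _ (ltW x1y1))// le_max lexx orbT.
rewrite !in_itv/= => /andP[qy' y'r] /andP[qx' x'r].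
have x'y' : x' < y'.
  rewrite ltNge; apply/negP => /(derive_gt0_le qy' x'r).
  by rewrite x'E y'E leNgt x1y1.
rewrite [X in integral _ X _](_ : _ = `]x', y']%classic); last first.
  apply/seteqP; split => z /=; rewrite !in_itv/=.
    move=> [/andP[qz zr] /andP[xz zy]]; apply/andP; split.
      rewrite ltNge; apply/negP => zx'.
      have := derive_gt0_le (ltW qz) x'r zx'.
      by rewrite x'E leNgt gt_max xz derive_gt0_lt.
    rewrite leNgt; apply/negP => y'z; have := derive_gt0_lt qy' zr y'z.
    by rewrite y'E ltNge le_min zy derive_gt0_le// ltW.
  move=> /andP[x'z zy']; rewrite (le_lt_trans qx')//= (le_trans zy')//.
  split=> //; apply/andP; split.
    rewrite (@le_lt_trans _ _ x1)// ?le_max ?lexx// -x'E derive_gt0_lt//.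
    exact: le_trans zy' _.
  rewrite (@le_trans _ _ y1)//; last by rewrite ge_min lexx.
  by rewrite -y'E derive_gt0_le// (le_trans qx')// ltW.
rewrite lebesgue_measure_itv/= lte_fin x1y1 -x'E -y'E.
rewrite integral_itv_obnd_cbnd; last first.
  apply/measurable_EFinP; apply: measurable_funTS.
  exact: continuous_measurable_fun.
rewrite (@continuous_FTC2 R dphi phi)//.
- exact: continuous_subspaceT.
- split=> [z _ //||].
  + exact/cvg_at_right_filter/cphi.
  + exact/cvg_at_left_filter/cphi.
- by move=> z _; rewrite derive1E derive_val.
Qed.

(** Lebesgue measure is determined by its values on half-open intervals. Completing [nu1] by
    Lebesgue measure off [E] gives a measure with those values; evaluating it on subsets of [E]
    leaves only [nu1]. *)
Lemma increasing_change_of_variables (A : set R) : measurable A ->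
  (\int[leb]_(x in `]q, r] `&` phi @^-1` A) (dphi x)%:E)%E =
  leb (A `&` `]phi q, phi r]).
Proof.
move=> mA.
pose nu := measure_add nu1 (mrestr leb (measurableC mE)).
have nuD B : nu B = (nu1 B + leb (B `&` ~` E))%E by exact: measure_addE.
have nuE B : measurable B -> leb B = nu B.
  move=> mB; apply: lebesgue_measure_unique => // _ [[x y]] _ <-.
  transitivity (nu1 `]x, y]%classic + leb (`]x, y] `&` ~` E)%classic)%E.
    rewrite nu1_itv -measureU//.
    - by rewrite -setIUr setUv setIT.
    - by apply: measurableI => //; exact: measurable_itv.
    - apply: measurableI; [exact: measurable_itv|exact: measurableC].
    - by rewrite setIACA setICr setI0.
  exact/esym/nuD.
rewrite nuE; last exact: measurableI.
rewrite nuD -setIA setICr setI0 measure0 adde0.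
rewrite nu1E; last exact: measurableI.
congr (integral _ _ _); apply/seteqP; split => x /= [xqr Ax]; split => //=.
- split => //; move: xqr; rewrite !in_itv/= => /andP[qx xr].
  by rewrite derive_gt0_lt//= derive_gt0_le// ltW.
- by case: Ax.
Qed.

End substitution.

Lemma bigcup_null d (T : measurableType d) (R : realType)
    (m : {measure set T -> \bar R}) (F : (set T)^nat) :
  (forall n, measurable (F n)) -> (forall n, m (F n) = 0%E) ->
  m (\bigcup_n F n) = 0%E.
Proof.
move=> mF F0; apply/negligibleP; first exact: bigcupT_measurable.
by apply: negligible_bigcup => n; apply/negligibleP; [exact: mF|exact: F0].
Qed.

Lemma integral0_gt0_null d (T : measurableType d) (R : realType)
    (m : {measure set T -> \bar R}) (D : set T) (f : T -> \bar R) :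
  measurable D -> measurable_fun D f -> (forall x, D x -> 0 < f x)%E ->
  (\int[m]_(x in D) f x = 0)%E -> m D = 0%E.
Proof.
move=> mD mf f0 If.
have : (\int[m]_(x in D) `|f x| = 0)%E.
  rewrite -If; apply: eq_integral => x /set_mem Dx.
  by rewrite gee0_abs// ltW// f0.
move=> /(ae_eq_integral_abs _ mD mf)[N [mN N0 DN]].
apply: (subset_measure0 mD mN _ N0) => x Dx; apply: DN => /= /(_ Dx) fx.
by have := f0 _ Dx; rewrite fx ltxx.
Qed.

(** * Tonelli's theorem over a measurable set and null sections *)

Section tonelli_set.
Local Open Scope ereal_scope.
Context d1 d2 (T1 : measurableType d1) (T2 : measurableType d2) (R : realType).
Variables (m1 : {sigma_finite_measure set T1 -> \bar R})
  (m2 : {sigma_finite_measure set T2 -> \bar R}).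
Variables (S : set (T1 * T2)) (k : T1 * T2 -> \bar R).
Hypotheses (mS : measurable S) (mk : measurable_fun S k)
  (k0 : forall z, S z -> 0 <= k z).

Let mkS : measurable_fun setT (k \_ S).
Proof. exact/(measurable_restrictT _ mS). Qed.

Let kS0 z : 0 <= (k \_ S) z.
Proof. by rewrite patchE; case: ifPn => // /set_mem; exact: k0. Qed.

Lemma tonelli_set1 : \int[m1 \x m2]_(z in S) k z =
  \int[m1]_x \int[m2]_(y in [set y | S (x, y)]) k (x, y).
Proof.
rewrite integral_mkcond (fubini_tonelli1 _ mkS kS0); apply: eq_integral => x _.
rewrite [RHS]integral_mkcond; apply: eq_integral => y _.
by rewrite !patchE; congr (if _ then _ else _); apply: asbool_equiv_eq.
Qed.

Lemma tonelli_set2 : \int[m1 \x m2]_(z in S) k z =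
  \int[m2]_y \int[m1]_(x in [set x | S (x, y)]) k (x, y).
Proof.
rewrite integral_mkcond (fubini_tonelli2 _ mkS kS0); apply: eq_integral => y _.
rewrite [RHS]integral_mkcond; apply: eq_integral => x _.
by rewrite !patchE; congr (if _ then _ else _); apply: asbool_equiv_eq.
Qed.

Lemma measurable_tonelli_set1 :
  measurable_fun setT (fun x => \int[m2]_(y in [set y | S (x, y)]) k (x, y)).
Proof.
apply: eq_measurable_fun (measurable_fun_fubini_tonelli_F _ mkS kS0) => x _.
rewrite /fubini_F [RHS]integral_mkcond; apply: eq_integral => y _.
by rewrite !patchE; congr (if _ then _ else _); apply: asbool_equiv_eq.
Qed.

Lemma measurable_tonelli_set2 :
  measurable_fun setT (fun y => \int[m1]_(x in [set x | S (x, y)]) k (x, y)).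
Proof.
apply: eq_measurable_fun (measurable_fun_fubini_tonelli_G _ mkS kS0) => y _.
rewrite /fubini_G [RHS]integral_mkcond; apply: eq_integral => x _.
by rewrite !patchE; congr (if _ then _ else _); apply: asbool_equiv_eq.
Qed.

End tonelli_set.

Lemma measurable_preimage d1 d2 (T1 : measurableType d1)
    (T2 : measurableType d2) (f : T1 -> T2) (A : set T2) :
  measurable_fun setT f -> measurable A -> measurable [set x | A (f x)].
Proof. by move=> mf mA; rewrite -[X in measurable X]setTI; exact: mf. Qed.

Lemma measurable_set_ltr d (T : measurableType d) (R : realType)
    (f g : T -> R) :
  measurable_fun setT f -> measurable_fun setT g ->
  measurable [set x | f x < g x].
Proof.
move=> mf mg; exact: (measurable_preimage (A := [set true])
  (measurable_fun_ltr mf mg)).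
Qed.

Lemma measurable_set_ler d (T : measurableType d) (R : realType)
    (f g : T -> R) :
  measurable_fun setT f -> measurable_fun setT g ->
  measurable [set x | f x <= g x].
Proof.
move=> mf mg; exact: (measurable_preimage (A := [set true])
  (measurable_fun_ler mf mg)).
Qed.

(** Tonelli for the constant 1: the measure of the sections is a nonnegative function with zero
    integral. *)
Lemma null_ysection d1 d2 (T1 : measurableType d1) (T2 : measurableType d2)
    (R : realType) (m1 : {sigma_finite_measure set T1 -> \bar R})
    (m2 : {sigma_finite_measure set T2 -> \bar R}) (Q : set (T1 * T2)) :
  measurable Q -> (m1 \x m2)%E Q = 0%E ->
  {ae m2, forall y, m1 [set x | Q (x, y)] = 0%E}.
Proof.
move=> mQ Q0.
have mc : measurable_fun Q (cst (1 : \bar R)%E) by [].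
have c0 z : Q z -> (0 <= cst (1 : \bar R) z)%E by [].
have E y : (\int[m1]_(x in [set x | Q (x, y)]) cst 1%E (x, y) =
    m1 [set x | Q (x, y)])%E.
  have mQy : measurable [set x | Q (x, y)].
    by apply: measurable_preimage mQ; exact: pair2_measurable.
  transitivity (\int[m1]_(x in [set x | Q (x, y)]) cst 1%E x)%E; first by [].
  by rewrite integral_cst// mul1e.
have I0 : (\int[m2]_y \int[m1]_(x in [set x | Q (x, y)]) cst 1 (x, y) = 0)%E.
  rewrite -(tonelli_set2 m1 m2 mQ mc c0).
  have -> : (\int[m1 \x m2]_(z in Q) cst 1 z = 1 * (m1 \x m2) Q)%E.
    exact: integral_cst.
  by rewrite Q0 mule0.
have mF := measurable_tonelli_set2 m1 mQ mc c0.
have : (\int[m2]_y `| \int[m1]_(x in [set x | Q (x, y)]) cst 1%E (x, y) | = 0)%E.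
  by rewrite -I0; apply: eq_integral => y _; rewrite gee0_abs// integral_ge0.
move=> /ae_eq_integral_abs; move/(_ measurableT mF).
by apply: filterS => y /(_ I); rewrite E.
Qed.

Lemma null_xsection d1 d2 (T1 : measurableType d1) (T2 : measurableType d2)
    (R : realType) (m1 : {sigma_finite_measure set T1 -> \bar R})
    (m2 : {sigma_finite_measure set T2 -> \bar R}) (Q : set (T1 * T2)) :
  measurable Q -> (m1 \x m2)%E Q = 0%E ->
  {ae m1, forall x, m2 [set y | Q (x, y)] = 0%E}.
Proof.
move=> mQ Q0.
have mc : measurable_fun Q (cst (1 : \bar R)%E) by [].
have c0 z : Q z -> (0 <= cst (1 : \bar R) z)%E by [].
have E x : (\int[m2]_(y in [set y | Q (x, y)]) cst 1%E (x, y) =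
    m2 [set y | Q (x, y)])%E.
  have mQx : measurable [set y | Q (x, y)].
    by apply: measurable_preimage mQ; exact: pair1_measurable.
  transitivity (\int[m2]_(y in [set y | Q (x, y)]) cst 1%E y)%E; first by [].
  by rewrite integral_cst// mul1e.
have I0 : (\int[m1]_x \int[m2]_(y in [set y | Q (x, y)]) cst 1 (x, y) = 0)%E.
  rewrite -(tonelli_set1 m1 m2 mQ mc c0).
  have -> : (\int[m1 \x m2]_(z in Q) cst 1 z = 1 * (m1 \x m2) Q)%E.
    exact: integral_cst.
  by rewrite Q0 mule0.
have mF := measurable_tonelli_set1 m2 mQ mc c0.
have : (\int[m1]_x `| \int[m2]_(y in [set y | Q (x, y)]) cst 1%E (x, y) | = 0)%E.
  by rewrite -I0; apply: eq_integral => x _; rewrite gee0_abs// integral_ge0.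
move=> /ae_eq_integral_abs; move/(_ measurableT mF).
by apply: filterS => x /(_ I); rewrite E.
Qed.

Lemma lebesgue_integral_shift (R : realType) (c : R) (B : set R)
    (g : R -> \bar R) :
  measurable B -> measurable_fun B g -> (forall x, B x -> 0 <= g x)%E ->
  (\int[lebesgue_measure]_(v in [set v | B (v - c)%R]) g (v - c)%R =
   \int[lebesgue_measure]_(u in B) g u)%E.
Proof.
move=> mB mg g0.
pose phi (v : measurableTypeR R) : measurableTypeR R := (v : R) - c.
have mphi : measurable_fun setT phi by exact: measurable_funB.
have -> : (\int[lebesgue_measure]_(u in B) g u =
    \int[pushforward lebesgue_measure phi]_(u in B) g u)%E.
  apply: eq_measure_integral.
  move=> A mA _; apply: lebesgue_measure_unique => // _ [[x y]] _ <-.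
  transitivity (@lebesgue_measure R `](x + c), (y + c)]).
    rewrite !lebesgue_measure_itv/= !lte_fin ltrD2r; case: ifP => // _.
    by rewrite -!EFinB; congr EFin; ring.
  congr lebesgue_measure; apply/seteqP; split => t; rewrite /phi/= !in_itv/=;
    by rewrite ltrBrDr lerBlDr.
by rewrite ge0_integral_pushforward// => y /set_mem; exact: g0.
Qed.

Lemma subset_lebesgue_measure (R : realType) (A B : set R) :
  measurable A -> measurable B -> A `<=` B ->
  (lebesgue_measure A <= lebesgue_measure B)%E.
Proof.
move=> mA mB AB; apply: le_measure => //; apply/mem_set.
- exact: mA.
- exact: mB.
Qed.

Lemma subset_lebesgue_measure0 (R : realType) (A B : set R) :
  measurable A -> measurable B -> A `<=` B ->
  lebesgue_measure B = 0%E -> lebesgue_measure A = 0%E.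
Proof.
move=> mA mB AB B0; exact: (@subset_measure0 _ (measurableTypeR R) R
  lebesgue_measure A B mA mB AB B0).
Qed.

(** By continuity, the set where [dphi] is positive is covered by countably many rational intervals
    on which it stays positive. On each of them the change of variables gives a positive function
    zero integral over the preimage of [N]. *)
Lemma derive_gt0_preimage_null (R : realType) (phi dphi : R -> R) (N : set R) :
  (forall x : R, is_derive x 1 phi (dphi x)) -> continuous dphi ->
  measurable N -> lebesgue_measure N = 0%E ->
  lebesgue_measure [set t | 0 < dphi t /\ N (phi t)] = 0%E.
Proof.
move=> dphiE cdphi mN N0.
have cphi : continuous phi.
  by move=> x; apply/differentiable_continuous/derivable1_diffP.
have mphiN : measurable [set t | N (phi t)].
  by apply: measurable_preimage => //; exact: continuous_measurable_fun.
have mdphi : measurable_fun setT dphi by exact: continuous_measurable_fun.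
pose good (c : rat * rat) := ratr c.1 < (ratr c.2 : R) /\
  forall x : R, ratr c.1 <= x <= ratr c.2 -> 0 < dphi x.
pose J (c : rat * rat) : set R := `]ratr c.1, ratr c.2]%classic.
(* Pairs of rationals are enumerated by natural numbers, so that the negligibility of a union of a
   sequence applies. *)
pose F n : set (measurableTypeR R) := if unpickle n is Some c then
  [set t | good c /\ (J c `&` (phi @^-1` N)) t] else set0.
have FE c : F (pickle c) = [set t | good c /\ (J c `&` (phi @^-1` N)) t].
  by rewrite /F pickleK.
apply/(negligibleP _ _).1.
  by apply: measurableI => //; exact: measurable_set_ltr.
apply: (negligibleS (A := \bigcup_n F n)).
  move=> t /= [dt Nt].
  have /nbhs_ballP[e /= e0 eU] : nbhs t [set x | 0 < dphi x].
    exact: (cvgr_gt _ (cdphi t)).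
  have [c] := @rat_in_itvoo R (t - e) t (ltac:(by rewrite ltrBlDr ltrDl)).
  have [c'] := @rat_in_itvoo R t (t + e) (ltac:(by rewrite ltrDl)).
  rewrite !in_itv/= => /andP[tc' c'e] /andP[ec ct].
  exists (pickle (c, c')); first exact: I.
  rewrite FE; split; last first.
    by split => //; rewrite /J/= in_itv/= ct ltW.
  split => /=; first exact: lt_trans tc'.
  move=> x /andP[cx xc']; apply: eU; rewrite /ball/= ltr_norml.
  by apply/andP; split; lra.
apply: negligible_bigcup => n; rewrite /F.
case: (unpickle n) => [c|]; last exact: negligible_set0.
have [[cc gc]|ngc] := pselect (good c); last first.
  by apply: negligibleS (negligible_set0 _) => t [].
apply: (negligibleS (A := (J c `&` (phi @^-1` N) : set (measurableTypeR R)))); first by move=> t [].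
have mI : measurable (J c `&` phi @^-1` N).
  by apply: measurableI => //; exact: measurable_itv.
apply/negligibleP => //.
apply: (@integral0_gt0_null _ (measurableTypeR R) R lebesgue_measure _
  (fun x => (dphi x)%:E)) => //.
- by apply/measurable_EFinP; exact: measurable_funTS.
- by move=> x [/= + _]; rewrite /J/= in_itv/= => /andP[cx xc]; rewrite lte_fin gc// xc ltW.
rewrite (increasing_change_of_variables cc dphiE cdphi gc)//.
apply: (subset_lebesgue_measure0 _ mN _ N0) => //.
by apply: measurableI => //; exact: measurable_itv.
Qed.

(** * Time changes of the flow *)

(* Addition of [Om], typed on the Borel space so that measurability is inferred. *)
Definition translate {Om : topologicalZmodType} (w : borel_type Om) (x : Om) :
  borel_type Om := (w : Om) + x.

Section flow.
Context {R : realType} {Om : topologicalZmodType}.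
Variables (psi : R -> Om) (mu : probability (borel_type Om) R).
Local Notation X := (borel_type Om).
Local Notation leb := (@lebesgue_measure R).
Hypotheses (cpsi : continuous psi)
  (psiD : forall s t, psi (s + t) = psi s + psi t).
Hypothesis mu_trans : forall (x : Om) (A : set Om),
  measurable (A : set X) -> mu ([set y + x | y in A] : set X) = mu A.

Lemma psi0 : psi 0 = 0.
Proof. by apply: (addrI (psi 0)); rewrite -psiD !addr0. Qed.

Lemma flow_continuous : continuous (fun z : Om * R => z.1 + psi z.2).
Proof.
move=> z; apply: (@continuous_comp _ _ _ (fun z : Om * R => (z.1, psi z.2))
  (fun z : Om * Om => z.1 + z.2)); last exact: add_continuous.
apply: cvg_pair => /=; first exact: cvg_fst.
by apply: continuous_comp; [exact: cvg_snd|exact: cpsi].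
Qed.

Lemma flow_measurable :
  measurable_fun setT (fun z : X * R => translate z.1 (psi z.2)).
Proof. exact: (continuous_prod_measurable_fun flow_continuous). Qed.

Lemma addr_continuous (x : Om) : continuous (fun w : Om => w + x).
Proof.
move=> w; apply: (@continuous_comp _ _ _ (fun w : Om => (w, x))
  (fun z : Om * Om => z.1 + z.2)); last exact: add_continuous.
by apply: cvg_pair => /=; [exact: cvg_id|exact: cvg_cst].
Qed.

Lemma orbit_continuous w : continuous (fun t => w + psi t).
Proof.
have -> : (fun t => w + psi t) = (fun x => x + w) \o psi.
  by apply/funext => t /=; rewrite addrC.
move=> t; apply: continuous_comp; [exact: cpsi|exact: addr_continuous].
Qed.

Lemma shift_measurable (x : Om) : measurable_fun setT (fun w : X => translate w x).
Proof.
apply: measurability; first by [].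
move=> _ [B oB <-]; rewrite setTI; apply: sub_sigma_algebra.
by have /continuousP := @addr_continuous x; exact.
Qed.

Lemma integral_shift (x : Om) (B : set X) (g : X -> \bar R) :
  measurable B -> measurable_fun B g -> (forall w, B w -> 0 <= g w)%E ->
  (\int[mu]_(w in [set w | B (translate w x)]) g (translate w x) =
   \int[mu]_(w in B) g w)%E.
Proof.
move=> mB mg g0.
have -> : (\int[mu]_(w in B) g w =
    \int[pushforward mu (fun w : X => translate w x)]_(w in B) g w)%E.
  apply: eq_measure_integral; first exact: shift_measurable.
  move=> mf A mA _.
  transitivity (mu [set w | A (translate w x)]); last by [].
  rewrite -[RHS](mu_trans x); last first.
    by apply: measurable_preimage => //; exact: shift_measurable.
  congr (mu _); apply/seteqP; split => [y Ay|_ [y Ay <-]//].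
  by exists ((y : Om) - x) => /=; rewrite /translate subrK.
rewrite ge0_integral_pushforward//.
- exact: shift_measurable.
- by move=> y /set_mem; exact: g0.
Qed.

Section flow_average.
Variables (D : set R) (B : set X) (g : X -> \bar R).
Hypotheses (mD : measurable D) (mB : measurable B).
Hypotheses (mg : measurable_fun B g) (g0 : forall w, B w -> (0 <= g w)%E).

Let S : set (X * R) := [set z | D z.2 /\ B (translate z.1 (psi z.2))].
Let k (z : X * R) := g (translate z.1 (psi z.2)).

Let mS : measurable S.
Proof.
apply: measurableI; first by apply: measurable_preimage mD; exact: measurable_snd.
by apply: measurable_preimage => //; exact: flow_measurable.
Qed.

Let mk : measurable_fun S k.
Proof.
apply: (@measurable_comp _ _ _ _ _ _ B) => //.
  by move=> _ [z [_ Bz] <-].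
exact: measurable_funTS flow_measurable.
Qed.

Let k0 z : S z -> (0 <= k z)%E.
Proof. by move=> [_]; exact: g0. Qed.

Lemma measurable_flow_average : measurable_fun setT (fun w : X =>
  \int[leb]_(t in D `&` [set t | B (translate w (psi t))])
    g (translate w (psi t)))%E.
Proof. exact: (measurable_tonelli_set1 leb mS mk k0). Qed.

(** After exchanging the integrals, translation invariance of [mu] makes the inner integral the same
    for every [t] in [D]. This transfers one-dimensional facts on orbits to [Om]. *)
Lemma flow_average :
  (\int[mu]_w \int[leb]_(t in D `&` [set t | B (translate w (psi t))])
      g (translate w (psi t)) =
  leb D * \int[mu]_(w in B) g w)%E.
Proof.
transitivity (\int[mu \x leb]_(z in S) k z)%E.
  exact/esym/(tonelli_set1 mu leb mS mk k0).
etransitivity; first exact: (tonelli_set2 mu leb mS mk k0).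
transitivity (\int[leb]_(t in D) cst (\int[mu]_(w in B) g w) t)%E; last first.
  by rewrite integral_cst//= muleC.
rewrite [RHS]integral_mkcond; apply: eq_integral => t _.
rewrite patchE; case: ifPn => [/set_mem qt|/negP qt].
  rewrite -(integral_shift (psi t) mB mg g0); congr (integral _ _ _).
  by apply/seteqP; split => w; [case|].
rewrite [X in integral _ X _](_ : _ = set0) ?integral_set0//.
by apply/seteqP; split => w // [/= qt' _]; apply: qt; exact/mem_set.
Qed.

End flow_average.

Lemma orbit_measurable w (A : set X) : measurable A ->
  measurable [set t | A (translate w (psi t))].
Proof.
move=> mA; apply: (@measurable_preimage _ _ _ _ (fun t : R => translate w (psi t))) => //.
apply: (@measurableT_comp _ _ _ _ _ _ (fun z : X * R => translate z.1 (psi z.2)) _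
  (fun t : R => (w, t))); first exact: flow_measurable.
exact: measurable_fun_pair.
Qed.

Section flow_average_indic.
Variables (D : set R) (B : set X).
Hypotheses (mD : measurable D) (mB : measurable B).

Let intE w : (\int[leb]_(t in D `&` [set t | B (translate w (psi t))])
    (cst 1) (translate w (psi t)) =
  leb (D `&` [set t | B (translate w (psi t))]))%E.
Proof.
transitivity (\int[leb]_(t in D `&` [set t | B (translate w (psi t))]) cst 1 t)%E.
  by [].
rewrite integral_cst ?mul1e//; apply: measurableI => //.
exact: orbit_measurable.
Qed.

Lemma flow_average_indic :
  (\int[mu]_w leb (D `&` [set t | B (translate w (psi t))]) = leb D * mu B)%E.
Proof.
rewrite -[mu B]mul1e -integral_cst// -flow_average//.
by apply: eq_integral => w _; rewrite intE.
Qed.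

Lemma measurable_flow_indic : measurable_fun setT
  (fun w : X => leb (D `&` [set t | B (translate w (psi t))])).
Proof.
apply: eq_measurable_fun (@measurable_flow_average D B (cst 1%E) mD mB _ _) => //.
Qed.

End flow_average_indic.

(** The average over the whole line is [leb setT * mu A], which is 0 by the convention that infinity
    times 0 is 0. *)
Lemma flow_null_line (A : set X) : measurable A -> mu A = 0%E ->
  {ae mu, forall w, leb [set t | A (translate w (psi t))] = 0%E}.
Proof.
move=> mA A0.
have : (\int[mu]_w `| leb (setT `&` [set t | A (translate w (psi t))]) | = 0)%E.
  under eq_integral do rewrite gee0_abs//.
  by rewrite flow_average_indic// A0 mule0.
move=> /ae_eq_integral_abs.
move/(_ measurableT (measurable_flow_indic measurableT mA)).
by apply: filterS => w; rewrite setTI; exact.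
Qed.

Section time_change.
Variables (h dh : Om -> R).
Hypotheses (ch : continuous h) (cdh : continuous dh).
Hypothesis hE : forall w (t : R),
  is_derive t 1 (fun t => h (w + psi t)) (dh (w + psi t)).

Lemma time_change_measurable (A : set X) : measurable A ->
  measurable [set w : X | A (translate w (psi (h w)))].
Proof.
move=> mA; apply: (@measurable_preimage _ _ _ _ (fun w : X => translate w (psi (h w)))) => //.
apply: (@measurableT_comp _ _ _ _ _ _ (fun z : X * R => translate z.1 (psi z.2)) _
  (fun w : X => (w, h w))); first exact: flow_measurable.
apply: measurable_fun_pair => //.
exact: continuous_borel_measurable_fun.
Qed.

Lemma time_change_derive w (t : R) :
  is_derive t 1 (fun t => t + h (w + psi t)) (1 + dh (w + psi t)).
Proof. by apply: is_deriveD; exact: hE. Qed.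

Lemma time_change_continuous w : continuous (fun t => 1 + dh (w + psi t)).
Proof.
move=> t; apply: continuousD; first exact: cvg_cst.
by apply: continuous_comp; [exact: orbit_continuous|exact: cdh].
Qed.

(** In the time coordinate of an orbit, [w |-> w + psi (h w)] becomes the real map
    [t |-> t + h (w + psi t)], with derivative [1 + dh (w + psi t)]. *)
Lemma time_change_orbit w t :
  translate (translate w (psi t)) (psi (h (translate w (psi t)))) =
  translate w (psi (t + h (translate w (psi t)))).
Proof. by rewrite /translate psiD addrA. Qed.

(** Almost every orbit meets [A] in a null set of times, and the one-dimensional result pulls this
    set back. Averaging over orbit segments of length 1 recovers [mu]. *)
Lemma time_change_null (A : set X) : measurable A -> mu A = 0%E ->
  mu [set w : X | 0 < 1 + dh w /\ A (translate w (psi (h w)))] = 0%E.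
Proof.
move=> mA A0; set Z := [set w : X | _].
have mZ : measurable Z.
  apply: measurableI; last exact: time_change_measurable.
  apply: measurable_set_ltr => //; apply: measurable_funD => //.
  exact: continuous_borel_measurable_fun.
have Aw0 := flow_null_line mA A0.
have : (leb `]0%R, 1%R] * mu Z = 0)%E; last first.
  by rewrite lebesgue_measure_itv/= lte_fin ltr01 oppr0 adde0 mul1e.
rewrite -flow_average_indic//.
rewrite (@ge0_ae_eq_integral _ _ _ _ setT _ (cst 0%E))//; last 2 first.
- exact: measurable_flow_indic.
- apply: filterS Aw0 => w Aw0 _ /=.
  have := derive_gt0_preimage_null (time_change_derive w)
    (time_change_continuous (w := w)) (orbit_measurable w mA) Aw0.
  apply: subset_lebesgue_measure0.
  + by apply: measurableI; [exact: measurable_itv|exact: orbit_measurable].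
  + apply: measurableI.
      apply: measurable_set_ltr => //.
      by apply: continuous_measurable_fun; exact: time_change_continuous.
    have mphi : measurable_fun setT (fun t : R => t + h ((w : Om) + psi t)).
      apply: continuous_measurable_fun => t.
      apply/differentiable_continuous/derivable1_diffP.
      by case: (time_change_derive w t).
    exact: (@measurable_preimage _ _ R R _ _ mphi (orbit_measurable w mA)).
  + by move=> t [_] /= [dt]; rewrite time_change_orbit.
by rewrite integral0.
Qed.

(* Averaging over the orbit segment [[0, L]] turns the integral into the measure
   of a segment that differs from [[0, L]] by at most [2 C]; then [L] goes to
   infinity. *)
Lemma time_change_integral (C : R) (A : set X) :
  (forall w, `|h w| <= C) -> (forall w, 0 < 1 + dh w) -> measurable A ->
  (\int[mu]_(w in [set w : X | A (translate w (psi (h w)))]) (1 + dh w)%:E =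
   mu A)%E.
Proof.
move=> hC dh0 mA; set B := [set w : X | _]; set J := integral _ _ _.
have mB : measurable B by exact: time_change_measurable.
have mdh : measurable_fun setT (fun w : X => 1 + dh w).
  by apply: measurable_funD => //; exact: continuous_borel_measurable_fun.
have mg : measurable_fun B (fun w : X => (1 + dh w)%:E).
  by apply/measurable_EFinP; exact: measurable_funTS.
have g0 w : B w -> (0 <= (1 + dh w)%:E)%E by move=> _; rewrite lee_fin ltW.
have C0 : 0 <= C by exact: le_trans (normr_ge0 _) (hC 0).
pose Aw (w : X) : set R := [set t | A (translate w (psi t))].
(* The time change of the orbit of [w] carries []0, L]] onto []h w, en L w]]. *)
pose en (L : R) (w : X) : R := L + h (translate w (psi L)).
have en0 L w : 0 < L ->
    (\int[leb]_(t in `]0%R, L] `&` [set t | B (translate w (psi t))])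
      (1 + dh (translate w (psi t)))%:E = leb (Aw w `&` `]h w, en L w]))%E.
  move=> L0.
  have := increasing_change_of_variables L0 (time_change_derive w)
    (time_change_continuous (w := w)) (fun t _ => dh0 _) (orbit_measurable w mA).
  rewrite psi0 addr0 add0r => <-; congr (integral _ _ _).
  by apply/seteqP; split => t [? /=]; rewrite /B/= time_change_orbit.
have key (L : R) : 0 < L ->
    (L%:E * J = \int[mu]_w leb (Aw w `&` `]h w, en L w]))%E.
  move=> L0; have := flow_average (measurable_itv `]0%R, L]) mB mg g0.
  rewrite lebesgue_measure_itv/= lte_fin L0 oppr0 adde0 => <-.
  by apply: eq_integral => w _; rewrite en0.
have meas (L : R) : 0 < L ->
    measurable_fun setT (fun w : X => leb (Aw w `&` `]h w, en L w])).
  move=> L0.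
  apply: eq_measurable_fun (measurable_flow_average (measurable_itv `]0%R, L]) mB mg g0) => w _.
  by rewrite en0.
have lei (p q : R) w : leb (`]p, q]%classic `&` Aw w) = leb (Aw w `&` `]p, q]).
  by rewrite setIC.
have mAw w (p q : R) : measurable (Aw w `&` `]p, q]).
  by apply: measurableI; [exact: orbit_measurable|exact: measurable_itv].
have hC' w : - C <= h w <= C by rewrite -ler_norml.
have hen L w : L - C <= en L w <= L + C.
  by have /andP[? ?] := hC' (translate w (psi L)); rewrite /en; lra.
have up L : 0 < L -> (L%:E * J <= (L + 2 * C)%:E * mu A)%E.
  move=> L0; rewrite key//.
  have -> : (L + 2 * C)%:E = leb `](- C), (L + C)].
    rewrite lebesgue_measure_itv/= lte_fin ifT; last lra.
    by rewrite -EFinB; congr EFin; ring.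
  rewrite -flow_average_indic//; apply: ge0_le_integral => //.
  - exact: meas.
  - exact: measurable_flow_indic.
  - move=> w _; rewrite lei; apply: subset_lebesgue_measure => // t [At].
    rewrite /= !in_itv/= => /andP[h1 h2]; split => //.
    by have /andP[? ?] := hC' w; have /andP[? ?] := hen L w; lra.
have lo L : 2 * C < L -> ((L - 2 * C)%:E * mu A <= L%:E * J)%E.
  move=> LC; have L0 : 0 < L by lra.
  rewrite key//.
  have -> : (L - 2 * C)%:E = leb `]C, (L - C)].
    rewrite lebesgue_measure_itv/= lte_fin ifT; last lra.
    by rewrite -EFinB; congr EFin; ring.
  rewrite -flow_average_indic//; apply: ge0_le_integral => //.
  - exact: measurable_flow_indic.
  - exact: meas.
  - move=> w _; rewrite lei; apply: subset_lebesgue_measure => // t [At].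
    rewrite /= !in_itv/= => /andP[h1 h2]; split => //.
    by have /andP[? ?] := hC' w; have /andP[? ?] := hen L w; lra.
have J0 : (0 <= J)%E by exact: integral_ge0.
have mAfin : mu A \is a fin_num by exact: fin_num_measure.
have Jfin : J \is a fin_num.
  rewrite ge0_fin_numE// -[J]mul1e (le_lt_trans (up 1 _))//.
  by rewrite ltey_eq fin_numM.
move: up lo; rewrite -(fineK Jfin) -(fineK mAfin).
move: (fine J) (fine (mu A)) => j m up lo.
have eps x c : (forall L, 2 * C < L -> L * x <= c) -> x <= 0.
  move=> H; rewrite leNgt; apply/negP => x0.
  have cx : 0 < (`|c| + 1) / x by rewrite divr_gt0// ltr_wpDl.
  have := H (2 * C + 1 + (`|c| + 1) / x) (ltac:(lra)).
  rewrite mulrDl divfK ?gt_eqF//; have := ler_norm c.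
  have : 0 < (2 * C + 1) * x by rewrite mulr_gt0//; lra.
  by lra.
apply/eqP; rewrite eqe eq_le; apply/andP; split; rewrite -subr_le0.
- apply: (eps _ (2 * C * m)) => L LC.
  have := up L (ltac:(lra)); rewrite -!EFinM lee_fin; lra.
- apply: (eps _ (2 * C * m)) => L LC.
  have := lo L LC; rewrite -!EFinM lee_fin; lra.
Qed.

End time_change.

(** The base points with a non-null velocity section lie in a [mu]-null set. Almost every orbit
    visits that set only during a null set of times, and Tonelli in the plane concludes. *)
Lemma flow_null_plane (N : set (X * R)) :
  measurable N -> (mu \x leb)%E N = 0%E ->
  {ae mu, forall w : X,
    (leb \x leb)%E [set z : R * R | N (translate w (psi z.1), z.2)] = 0%E}.
Proof.
move=> mN N0.
have [B [mB B0 NB]] := null_xsection (m1 := mu) (m2 := leb) mN N0.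
apply: filterS (flow_null_line mB B0) => w wB.
pose T : set (R * R) := [set z | N (translate w (psi z.1), z.2)].
have mT : measurable T.
  apply: (@measurable_preimage _ _ _ _
    (fun z : R * R => (translate w (psi z.1), z.2))) => //.
  apply: measurable_fun_pair => //.
  apply: (@measurableT_comp _ _ _ _ _ _
    (fun z : X * R => translate z.1 (psi z.2)) _
    (fun z : R * R => (w, z.1))); first exact: flow_measurable.
  exact: measurable_fun_pair.
have mc : measurable_fun T (cst (1 : \bar R)%E) by [].
have c0 z : T z -> (0 <= cst (1 : \bar R) z)%E by [].
transitivity (\int[leb \x leb]_(z in T) cst 1 z)%E.
  by rewrite -[LHS]mul1e; apply/esym; exact: integral_cst.
etransitivity; first exact: (tonelli_set1 leb leb mT mc c0).
rewrite (@ge0_ae_eq_integral _ _ _ _ setT _ (cst 0%E))//.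
- by rewrite integral0.
- exact: (measurable_tonelli_set1 leb mT mc c0).
- by move=> t _; exact: integral_ge0.
exists [set t | B (translate w (psi t))]; split => //.
- exact: orbit_measurable.
- move=> t /= h; apply: NB => /= Nt; apply: h => _.
  have mTt : measurable [set v | T (t, v)].
    by apply: measurable_preimage mT; exact: pair1_measurable.
  transitivity (\int[leb]_(v in [set v | T (t, v)]) cst 1%E v)%E; first by [].
  by rewrite integral_cst// mul1e.
Qed.

End flow.

(** * The ping-pong map on phase space *)

Section pingpong.
Context {R : realType} {Om : topologicalZmodType}.
Variables (psi : R -> Om) (mu : probability (borel_type Om) R).
Variables (a b : R) (P : Om -> R).
Local Notation X := (borel_type Om).
Local Notation leb := (@lebesgue_measure R).
Hypotheses (cptOm : compact [set: Om]) (cpsi : continuous psi)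
  (psiD : forall s t, psi (s + t) = psi s + psi t).
Hypothesis mu_trans : forall (x : Om) (A : set Om),
  measurable (A : set X) -> mu ([set y + x | y in A] : set X) = mu A.
Hypotheses (a_gt0 : 0 < a) (PC2 : C2psi psi P) (Pab : forall w, a <= P w <= b).
Local Notation dP := (dpsi psi P).
Local Notation ddP := (dpsi psi dP).
Local Notation vs := (2 * Num.max (sup (range dP)) 0).

Lemma dpsi_is_derive U : (forall w, has_dpsi psi U w) ->
  forall w (t : R),
    is_derive t 1 (fun t => U (w + psi t)) (dpsi psi U (w + psi t)).
Proof.
move=> dU w t; have [l dl] := dU (w + psi t).
have E : (fun h : R => h^-1 *: (((fun t : R => U (w + psi t)) \o shift t) (h *: 1)
    - U (w + psi t))) = dquot psi U (w + psi t).
  apply/funext => h; rewrite /dquot /= [h *: 1]mulr1 psiD.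
  by rewrite [_ *: _]mulrC addrA (addrAC w).
split; last by rewrite /derive E.
by apply/cvg_ex; exists l; rewrite E.
Qed.

Lemma continuous_bounded (U : Om -> R) : continuous U ->
  exists2 K, 0 < K & forall w, `|U w| <= K.
Proof.
move=> cU.
have [||c _ Uc] := @compact_EVT_max Om R (fun w => `|U w|) setT _ cptOm.
- by exists 0.
- by apply: continuous_subspaceT => w; apply: continuous_comp; [exact: cU|exact: norm_continuous].
exists (`|U c| + 1); first by rewrite ltr_wpDl.
by move=> w; rewrite (le_trans (Uc w _))// ?lerDl// inE.
Qed.

Lemma P_is_derive w (t : R) :
  is_derive t 1 (fun t => P (w + psi t)) (dP (w + psi t)).
Proof. by case: PC2 => _ h _ _ _; exact: dpsi_is_derive. Qed.

Lemma dP_is_derive w (t : R) :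
  is_derive t 1 (fun t => dP (w + psi t)) (ddP (w + psi t)).
Proof. by case: PC2 => _ _ _ h _; exact: dpsi_is_derive. Qed.

Lemma P_continuous : continuous P. Proof. by case: PC2. Qed.

Lemma dP_continuous : continuous dP. Proof. by case: PC2. Qed.

Lemma P_measurable : measurable_fun setT (P : X -> R).
Proof. exact: (continuous_borel_measurable_fun P_continuous). Qed.

Lemma dP_measurable : measurable_fun setT (dP : X -> R).
Proof. exact: (continuous_borel_measurable_fun dP_continuous). Qed.

Lemma ddP_continuous : continuous ddP. Proof. by case: PC2. Qed.

Lemma P_gt0 w : 0 < P w.
Proof. by have /andP[h _] := Pab w; exact: lt_le_trans h. Qed.

Lemma P_leb w : P w <= b.
Proof. by have /andP[] := Pab w. Qed.

Lemma P_gea w : a <= P w.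
Proof. by have /andP[] := Pab w. Qed.

Lemma b_gt0 : 0 < b.
Proof. exact: lt_le_trans (P_gt0 0) (P_leb 0). Qed.

Lemma vs_ge0 : 0 <= vs.
Proof. by rewrite mulr_ge0// le_max lexx orbT. Qed.

Lemma dP_le_vs w : 2 * dP w <= vs.
Proof.
rewrite ler_pM2l// le_max; apply/orP; left.
have [K _ dPK] := continuous_bounded dP_continuous.
apply: ub_le_sup; last by exists w.
by exists K => _ [x _ <-]; exact: le_trans (ler_norm _) (dPK x).
Qed.

Lemma vs_gt0 v : vs < v -> 0 < v.
Proof. by apply: le_lt_trans; exact: vs_ge0. Qed.

Lemma dP_lt v w : vs < v -> dP w < v.
Proof. by move=> vv; have := dP_le_vs w; have := vs_ge0; lra. Qed.

Section impact_time.
Variables (w : Om) (t0 v : R).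
Hypothesis vv : vs < v.

Let F s := (s - t0) * v - P (w + psi s).

Let dF (s : R) : is_derive s 1 F (v - dP (w + psi s)).
Proof.
rewrite /F; apply: is_deriveB; last exact: P_is_derive.
by apply: is_derive_eq; rewrite ?scaler0 ?add0r ?subr0 ?oppr0 ?addr0 [_ *: _]mulr1.
Qed.

Let cF : continuous F.
Proof. by move=> x; apply/differentiable_continuous/derivable1_diffP; case: (dF x). Qed.

Let F_lt s s' : s < s' -> F s < F s'.
Proof.
move=> ss; apply: (@derive_gt0_lt R F (fun s => v - dP (w + psi s)) s s') => //.
by move=> x _; rewrite subr_gt0 dP_lt.
Qed.

(** The intermediate value theorem on [[t0, t0 + b / v]]: the moving wall is at a positive position
    at [t0] and at most at [b] when the particle would reach [b]. *)
Lemma pp_tildeP :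
  (pp_tilde (fun t => P (w + psi t)) t0 v - t0) * v =
  P (w + psi (pp_tilde (fun t => P (w + psi t)) t0 v)).
Proof.
have v0 := vs_gt0 vv.
have [|||c _ Fc] := @IVT R F t0 (t0 + b / v) 0.
- by rewrite lerDl divr_ge0 ?ltW ?b_gt0.
- exact: continuous_subspaceT.
- have h0 : F t0 <= 0 by rewrite /F subrr mul0r sub0r oppr_le0 ltW ?P_gt0.
  have h1 : 0 <= F (t0 + b / v).
    by rewrite /F (addrC t0) addrK divfK ?gt_eqF// subr_ge0 P_leb.
  by rewrite ge_min h0/= le_max h1 orbT.
have := @xgetPex _ 0 [set s | (s - t0) * v = P (w + psi s)]; apply.
by exists c => /=; apply/eqP; rewrite -subr_eq0; apply/eqP.
Qed.

(** [F] is strictly increasing, since [vs < v] forces [dP < v]. *)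
Lemma pp_tilde_unique s : (s - t0) * v = P (w + psi s) ->
  pp_tilde (fun t => P (w + psi t)) t0 v = s.
Proof.
move=> es; have et := pp_tildeP; move: et; set t := pp_tilde _ _ _ => et.
have [ts|st|//] := ltgtP t s.
- by have := F_lt ts; rewrite /F et es !subrr ltxx.
- by have := F_lt st; rewrite /F et es !subrr ltxx.
Qed.

(** Replaces the implicitly defined impact time by an explicit inequality, which yields its
    measurability on open rays. *)
Lemma pp_tilde_lt s :
  (pp_tilde (fun t => P (w + psi t)) t0 v < s) = (P (w + psi s) < (s - t0) * v).
Proof.
have et := pp_tildeP; move: et; set t := pp_tilde _ _ _ => et.
rewrite -[RHS]subr_gt0 -/(F s).
have <- : F t = 0 by rewrite /F et subrr.
have [/F_lt->//|/F_lt|->] := ltgtP t s; last by rewrite ltxx.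
by move=> /ltW; rewrite leNgt => /negbTE.
Qed.

End impact_time.

Lemma pp_tilde_shift w t v : vs < v ->
  pp_tilde (fun s => P (w + psi s)) t v =
  t + pp_tilde (fun s => P (w + psi t + psi s)) 0 v.
Proof.
move=> vv; apply: pp_tilde_unique => //.
by rewrite psiD addrA -(pp_tildeP (w + psi t) 0 vv) subr0 addrC addKr.
Qed.

Lemma derive1_P w s : derive1 (fun t => P (w + psi t)) s = dP (w + psi s).
Proof. by rewrite derive1E; have := P_is_derive w s; case. Qed.

Definition impact_time (z : X * R) : R :=
  if vs < z.2 then pp_tilde (fun t => P ((z.1 : Om) + psi t)) 0 z.2 else 0.

Lemma impact_time_measurable : measurable_fun setT impact_time.
Proof.
apply: (measurability _ (RGenInftyO.measurableE R)) => _ [_ [s ->] <-].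
rewrite setTI.
have -> : impact_time @^-1` `]-oo, s[%classic =
    ([set z : X * R | vs < z.2] `&`
       [set z | P (translate z.1 (psi s)) < s * z.2]) `|`
    ([set z | z.2 <= vs] `&` [set z | 0 < s]).
  apply/seteqP; split => z /=; rewrite /impact_time/= in_itv/=;
      have [vz|vz] := ltP vs z.2.
  - by rewrite pp_tilde_lt// subr0; left.
  - by right.
  - by rewrite pp_tilde_lt// subr0 => -[[]|[]].
  - by move=> [[]|[]].
have mP : measurable_fun setT (fun z : X * R => P (translate z.1 (psi s))).
  apply: (@measurableT_comp _ _ _ _ _ _ (P : X -> R)); first exact: P_measurable.
  apply: (@measurableT_comp _ _ _ _ _ _ (fun w : X => translate w (psi s)) _ fst) => //.
  exact: shift_measurable.
apply: measurableU; apply: measurableI.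
- by apply: measurable_set_ltr.
- by apply: measurable_set_ltr => //; exact: measurable_funM.
- by apply: measurable_set_ler.
- by apply: measurable_set_ltr.
Qed.

(* The identity at low velocities is an arbitrary choice making the map total; it
   also forces every state that crosses a level of [adiabatic] to be fast. *)
Definition bounce (z : X * R) : X * R :=
  let th := translate z.1 (psi (impact_time z)) in
  let u := z.2 - 2 * dP th in
  if vs < z.2 then (translate th (psi (P th / u)), u) else z.

(** Moving the origin of time to the current impact replaces the forcing of [w] by that of
    [w + psi t], so the ping-pong maps of all [w] are semiconjugate to one autonomous map. *)
Lemma bounce_orbit (w : Om) t v : vs < v ->
  let y := pp_map (fun s => P (w + psi s)) (t, v) in
  bounce (w + psi t, v) = (w + psi y.1, y.2).
Proof.
move=> vv /=; rewrite /bounce/= vv /impact_time/= vv /translate.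
rewrite derive1_P (pp_tilde_shift w t vv) !psiD !addrA//.
Qed.

Lemma bounce_iter (w : Om) t v n :
  let y := pp_orbit (fun s => P (w + psi s)) (t, v) in
  (forall k, (k < n)%N -> vs < (y k).2) ->
  iter n bounce (w + psi t, v) = (w + psi (y n).1, (y n).2).
Proof.
move=> y; elim: n => [//|n ih] h; rewrite iterS ih; last first.
  by move=> k kn; apply: h; exact: ltnW.
by rewrite bounce_orbit ?h// /y /pp_orbit iterS; case: (iter n _ _).
Qed.

Lemma bounce_measurable : measurable_fun setT bounce.
Proof.
pose th (z : X * R) := translate z.1 (psi (impact_time z)).
pose u (z : X * R) := z.2 - 2 * dP (th z).
have mth : measurable_fun setT th.
  apply: (@measurableT_comp _ _ _ _ _ _ (fun z : X * R => translate z.1 (psi z.2)) _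
    (fun z : X * R => (z.1, impact_time z))); first exact: flow_measurable.
  by apply: measurable_fun_pair => //; exact: impact_time_measurable.
have mu' : measurable_fun setT u.
  apply: measurable_funB => //; apply: measurable_funM => //.
  exact: (@measurableT_comp _ _ _ _ _ _ _ _ _ dP_measurable mth).
have mPth : measurable_fun setT (fun z => P (th z) / u z).
  apply: measurable_funM.
    exact: (@measurableT_comp _ _ _ _ _ _ _ _ _ P_measurable mth).
  exact: (@measurableT_comp _ _ _ _ _ _ _ _ _ (@measurable_fun_inv R) mu').
apply: measurable_fun_ifT => //.
- by apply: measurable_fun_ltr.
- apply: measurable_fun_pair => //.
  apply: (@measurableT_comp _ _ _ _ _ _ (fun z : X * R => translate z.1 (psi z.2)) _
    (fun z : X * R => (th z, P (th z) / u z))); first exact: flow_measurable.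
  exact: measurable_fun_pair.
Qed.

Section time_change_P.
Variable r : R.

Let ch : continuous (fun w => r * P w).
Proof. by move=> w; apply: continuousM; [exact: cvg_cst|exact: P_continuous]. Qed.

Let cdh : continuous (fun w => r * dP w).
Proof. by move=> w; apply: continuousM; [exact: cvg_cst|exact: dP_continuous]. Qed.

Let hE w (t : R) : is_derive t 1 (fun t => r * P (w + psi t)) (r * dP (w + psi t)).
Proof. by apply: is_deriveZ; exact: P_is_derive. Qed.

Lemma measurable_time_change_P (A : set X) : measurable A ->
  measurable [set w : X | A (translate w (psi (r * P w)))].
Proof. exact: (time_change_measurable cpsi ch). Qed.

(** Both flights have this form: [r = - v^-1] traces the outward flight backwards from the moving
    wall, and [r = u^-1] describes the return. *)
Lemma time_change_P (A : set X) : (forall w, 0 < 1 + r * dP w) ->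
  measurable A ->
  (\int[mu]_(w in [set w : X | A (translate w (psi (r * P w)))])
    (1 + r * dP w)%:E = mu A)%E.
Proof.
move=> r0 mA.
apply: (time_change_integral cpsi psiD mu_trans ch cdh hE (C := `|r| * b)) => // w.
rewrite normrM ler_wpM2l// ger0_norm; first exact: P_leb.
exact/ltW/P_gt0.
Qed.

Lemma time_change_P_null (A : set X) : measurable A -> mu A = 0%E ->
  mu [set w : X | 0 < 1 + r * dP w /\ A (translate w (psi (r * P w)))] = 0%E.
Proof. exact: (time_change_null cpsi psiD mu_trans ch cdh hE). Qed.

End time_change_P.

(* The state at the next impact on the fixed wall, in terms of the state [z] right
   after the impact on the moving wall. *)
Definition outgoing (z : X * R) : X * R :=
  (translate z.1 (psi (z.2^-1 * P z.1)), z.2).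

Lemma outgoing_measurable : measurable_fun setT outgoing.
Proof.
apply: measurable_fun_pair => //.
apply: (@measurableT_comp _ _ _ _ _ _ (fun z : X * R => translate z.1 (psi z.2)) _
  (fun z : X * R => (z.1, z.2^-1 * P z.1))); first exact: flow_measurable.
apply: measurable_fun_pair => //; apply: measurable_funM.
  exact: (@measurableT_comp _ _ _ _ _ _ _ _ _ (@measurable_fun_inv R) measurable_snd).
exact: (@measurableT_comp _ _ _ _ _ _ _ _ _ P_measurable measurable_fst).
Qed.

(** Taking the point [w] of the impact on the moving wall as coordinate makes the implicit impact
    time explicit: the particle left the fixed wall [P w / v] earlier. *)
Lemma bounce_incoming w v : vs < v ->
  bounce (translate w (psi (- v^-1 * P w)), v) = outgoing (w, v - 2 * dP w).
Proof.
move=> vv; rewrite /bounce/= vv /impact_time/= vv.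
have e : translate (translate w (psi (- v^-1 * P w))) (psi (v^-1 * P w)) = w.
  by rewrite /translate -addrA -psiD mulNr addNr (psi0 psiD) addr0.
have -> : pp_tilde (fun t => P (translate w (psi (- v^-1 * P w)) + psi t)) 0 v =
    v^-1 * P w.
  apply: pp_tilde_unique => //; rewrite subr0 mulrC mulrA.
  have -> : P (translate w (psi (- v^-1 * P w)) + psi (v^-1 * P w)) = P w.
    by congr P.
  rewrite divff ?mul1r//.
  by rewrite gt_eqF// (vs_gt0 vv).
by rewrite e /outgoing/= mulrC.
Qed.

Let mdP1 : measurable_fun setT (fun z : X * R => dP z.1).
Proof. exact: (@measurableT_comp _ _ _ _ _ _ _ _ _ dP_measurable measurable_fst). Qed.

Let mP1 : measurable_fun setT (fun z : X * R => P z.1).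
Proof. exact: (@measurableT_comp _ _ _ _ _ _ _ _ _ P_measurable measurable_fst). Qed.

(** Confined to [vs < z.2], which excludes the states where [bounce] is set to the identity. *)
Definition bounce_preimage (Q : set (X * R)) : set (X * R) :=
  [set z | vs < z.2 /\ Q (bounce z)].

(** [z.2 + 2 * dP z.1] is the velocity before the impact on the moving wall. *)
Definition outgoing_preimage (Q : set (X * R)) : set (X * R) :=
  [set z | vs < z.2 + 2 * dP z.1 /\ Q (outgoing z)].

Lemma measurable_bounce_preimage (Q : set (X * R)) :
  measurable Q -> measurable (bounce_preimage Q).
Proof.
move=> mQ; apply: measurableI; first exact: measurable_set_ltr.
by apply: measurable_preimage => //; exact: bounce_measurable.
Qed.

Lemma measurable_outgoing_preimage (Q : set (X * R)) :
  measurable Q -> measurable (outgoing_preimage Q).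
Proof.
move=> mQ; apply: measurableI.
  apply: measurable_set_ltr => //; apply: measurable_funD => //.
  exact: measurable_funM.
by apply: measurable_preimage => //; exact: outgoing_measurable.
Qed.

(** For fixed [v], the time change with [r = - v^-1] has Jacobian [1 - dP / v] and turns the weight
    [v] into [v - dP]. For fixed [w], the collision is the shift [v = u + 2 * dP w], which turns it
    into [u + dP]. Only the return flight remains. *)
Lemma bounce_integral (Q : set (X * R)) : measurable Q ->
  (\int[mu \x leb]_(z in bounce_preimage Q) z.2%:E =
   \int[mu \x leb]_(z in outgoing_preimage Q) (z.2 + dP z.1)%:E)%E.
Proof.
move=> mQ.
pose S1 := bounce_preimage Q.
pose S2 : set (X * R) :=
  [set z | vs < z.2 /\ Q (outgoing (z.1, z.2 - 2 * dP z.1))].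
pose S3 := outgoing_preimage Q.
have mS1 : measurable S1 by exact: measurable_bounce_preimage.
have mS2 : measurable S2.
  apply: measurableI; first exact: measurable_set_ltr.
  apply: (@measurable_preimage _ _ _ _ (fun z : X * R => outgoing (z.1, z.2 - 2 * dP z.1))) => //.
  apply: (@measurableT_comp _ _ _ _ _ _ outgoing); first exact: outgoing_measurable.
  apply: measurable_fun_pair => //; apply: measurable_funB => //.
  exact: measurable_funM.
have mS3 : measurable S3 by exact: measurable_outgoing_preimage.
pose k1 (z : X * R) := z.2%:E.
pose k2 (z : X * R) := (z.2 - dP z.1)%:E.
pose k3 (z : X * R) := (z.2 + dP z.1)%:E.
have mk1 : measurable_fun S1 k1.
  by apply/measurable_EFinP; exact: measurable_funTS.
have mk2 : measurable_fun S2 k2.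
  by apply/measurable_EFinP; apply: measurable_funTS; exact: measurable_funB.
have mk3 : measurable_fun S3 k3.
  by apply/measurable_EFinP; apply: measurable_funTS; exact: measurable_funD.
have k10 z : S1 z -> (0 <= k1 z)%E.
  by move=> [/vs_gt0/ltW h _]; rewrite lee_fin.
have k20 z : S2 z -> (0 <= k2 z)%E.
  by move=> [h _]; rewrite lee_fin subr_ge0 ltW ?dP_lt.
have k30 z : S3 z -> (0 <= k3 z)%E.
  by move=> [/(@dP_lt _ z.1) h _]; rewrite lee_fin; lra.
transitivity (\int[mu \x leb]_(z in S2) k2 z)%E.
  etransitivity; first exact: (tonelli_set2 mu leb mS1 mk1 k10).
  etransitivity; last exact/esym/(tonelli_set2 mu leb mS2 mk2 k20).
  apply: eq_integral => v _.
  have [vv|vv] := ltP vs v; last first.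
    rewrite (_ : [set x | S1 (x, v)] = set0) ?integral_set0; last first.
      by apply/seteqP; split => w // [/=]; rewrite ltNge vv.
    rewrite (_ : [set x | S2 (x, v)] = set0) ?integral_set0//.
    by apply/seteqP; split => w // [/=]; rewrite ltNge vv.
  have v0 := vs_gt0 vv.
  pose A : set X := [set w | Q (bounce (w, v))].
  have mA : measurable A.
    apply: (@measurable_preimage _ _ _ _ (fun w : X => bounce (w, v))) => //.
    apply: (@measurableT_comp _ _ _ _ _ _ bounce); first exact: bounce_measurable.
    exact: pair2_measurable.
  have r0 w : 0 < 1 + (- v^-1) * dP w.
    rewrite mulNr subr_gt0 mulrC ltr_pdivrMr// mul1r; exact: dP_lt.
  rewrite (_ : [set x | S1 (x, v)] = A); last first.
    by apply/seteqP; split => w; [case|].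
  transitivity (v%:E * mu A)%E.
    transitivity (\int[mu]_(w in A) cst v%:E w)%E; first by [].
    by rewrite integral_cst.
  rewrite -(time_change_P r0 mA).
  rewrite -ge0_integralZl_EFin//; last 4 first.
  - exact: measurable_time_change_P.
  - by move=> w _; rewrite lee_fin ltW.
  - apply/measurable_EFinP; apply: measurable_funTS.
    by apply: measurable_funD => //; apply: measurable_funM => //; exact: dP_measurable.
  - exact: ltW.
  rewrite (_ : [set x | S2 (x, v)] = [set w | A (translate w (psi (- v^-1 * P w)))]); last first.
    apply/seteqP; split => w; rewrite /A/= bounce_incoming//; first by case.
  apply: eq_integral => w _; rewrite /k2/= -EFinM; congr EFin.
  by field; rewrite gt_eqF.
etransitivity; first exact: (tonelli_set1 mu leb mS2 mk2 k20).
etransitivity; last exact/esym/(tonelli_set1 mu leb mS3 mk3 k30).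
apply: eq_integral => w _.
have mB : measurable [set u | S3 (w, u)].
  by apply: measurable_preimage mS3; exact: pair1_measurable.
have mg : measurable_fun [set u | S3 (w, u)] (fun u => k3 (w, u)).
  apply/measurable_EFinP; apply: measurable_funTS => /=.
  exact: measurable_funD.
rewrite -(lebesgue_integral_shift (2 * dP w) mB mg); last by move=> u; exact: k30.
rewrite (_ : [set y | S2 (w, y)] = [set v | [set u | S3 (w, u)] (v - 2 * dP w)]); last first.
  by apply/seteqP; split => v; rewrite /S2 /S3 /outgoing_preimage/= subrK.
by apply: eq_integral => v _; rewrite /k2 /k3/=; congr EFin; ring.
Qed.

(** For almost every [u] the section of [Q] is null, and the return flight pulls null sets back
    wherever [1 + u^-1 * dP] is positive. This covers every state with incoming velocity above [vs],
    so no large velocity is required. *)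
Lemma bounce_null (Q : set (X * R)) : measurable Q ->
  (mu \x leb)%E Q = 0%E -> (mu \x leb)%E (bounce_preimage Q) = 0%E.
Proof.
move=> mQ Q0.
apply: (@integral0_gt0_null _ _ _ (mu \x leb)%E _ (fun z => z.2%:E)).
- exact: measurable_bounce_preimage.
- by apply/measurable_EFinP; exact: measurable_funTS.
- by move=> z [/vs_gt0 h _]; rewrite lte_fin.
rewrite bounce_integral//.
have mS := measurable_outgoing_preimage mQ.
pose k3 (z : X * R) := (z.2 + dP z.1)%:E.
have mk : measurable_fun (outgoing_preimage Q) k3.
  by apply/measurable_EFinP; apply: measurable_funTS; exact: measurable_funD.
have k0 z : outgoing_preimage Q z -> (0 <= k3 z)%E.
  by move=> [/(@dP_lt _ z.1) h _]; rewrite lee_fin; lra.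
etransitivity; first exact: (tonelli_set2 mu leb mS mk k0).
rewrite (@ge0_ae_eq_integral _ _ _ _ setT _ (cst 0%E))//.
- by rewrite integral0.
- exact: (measurable_tonelli_set2 mu mS mk k0).
- by move=> u _; apply: integral_ge0 => w; exact: k0.
have := null_ysection (m1 := mu) (m2 := leb) mQ Q0; apply: filterS => u Qu0 _ /=.
have mQu : measurable [set w | Q (w, u)].
  by apply: measurable_preimage mQ; exact: pair2_measurable.
have mSu : measurable [set w | outgoing_preimage Q (w, u)].
  by apply: measurable_preimage mS; exact: pair2_measurable.
have Su0 : mu [set w | outgoing_preimage Q (w, u)] = 0%E.
  have := time_change_P_null u^-1 mQu Qu0; apply: subset_measure0 => //.
    apply: measurableI.
      apply: measurable_set_ltr => //; apply: measurable_funD => //.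
      by apply: measurable_funM => //; exact: dP_measurable.
    exact: (measurable_time_change_P _ mQu).
  move=> w [/= h]; rewrite /outgoing/= => ?; split => //.
  have h1 := dP_lt w h; have h2 := dP_le_vs w.
  (* [u] exceeds [vs - 2 * dP w], which is nonnegative. *)
  have u0 : 0 < u by lra.
  by rewrite -(mulVf (lt0r_neq0 u0)) -mulrDr mulr_gt0 ?invr_gt0//; lra.
rewrite (eq_integral (fun w => `|k3 (w, u)|)%E); last first.
  by move=> w /set_mem h; rewrite gee0_abs//; exact: k0.
apply: integral_abs_eq0 => //.
by apply/measurable_EFinP; apply: measurable_funTS; apply: measurable_funD => //; exact: dP_measurable.
Qed.

(** For [u > K] the return flight has positive Jacobian [1 + dP / u] everywhere, so it turns the
    weight [u + dP] back into [u]. Equality is lost only in dropping the condition that the incoming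
    velocity exceeds [vs]. *)
Lemma bounce_subinvariant (K : R) (Q : set (X * R)) :
  (forall w, `|dP w| <= K) -> measurable Q -> Q `<=` [set z | K < z.2] ->
  (\int[mu \x leb]_(z in bounce_preimage Q) z.2%:E <=
   \int[mu \x leb]_(z in Q) z.2%:E)%E.
Proof.
move=> dPK mQ QK; rewrite bounce_integral//.
have dPK' w : - K <= dP w <= K by rewrite -ler_norml.
have K0 : 0 <= K by exact: le_trans (normr_ge0 _) (dPK 0).
pose S4 : set (X * R) := [set z | K < z.2 /\ Q (outgoing z)].
pose k3 (z : X * R) := (z.2 + dP z.1)%:E.
pose k1 (z : X * R) := z.2%:E.
have mS4 : measurable S4.
  apply: measurableI; first exact: measurable_set_ltr.
  by apply: measurable_preimage => //; exact: outgoing_measurable.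
have mk : measurable_fun S4 k3.
  by apply/measurable_EFinP; apply: measurable_funTS; exact: measurable_funD.
have k0 z : S4 z -> (0 <= k3 z)%E.
  by move=> [h _]; have /andP[? ?] := dPK' z.1; rewrite lee_fin; lra.
have mk1 : measurable_fun Q k1.
  by apply/measurable_EFinP; exact: measurable_funTS.
have k10 z : Q z -> (0 <= k1 z)%E by move=> /QK /= h; rewrite lee_fin; lra.
apply: (@le_trans _ _ (\int[mu \x leb]_(z in S4) k3 z)%E).
  apply: ge0_subset_integral => //.
  - exact: measurable_outgoing_preimage.
  - by move=> z [_ Qz]; split => //; exact: (QK _ Qz).
rewrite le_eqVlt; apply/orP; left; apply/eqP.
etransitivity; first exact: (tonelli_set2 mu leb mS4 mk k0).
etransitivity; last exact/esym/(tonelli_set2 mu leb mQ mk1 k10).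
apply: eq_integral => u _.
have [Ku|uK] := ltP K u; last first.
  rewrite (_ : [set x | S4 (x, u)] = set0) ?integral_set0; last first.
    by apply/seteqP; split => w // [/=]; rewrite ltNge uK.
  rewrite (_ : [set x | Q (x, u)] = set0) ?integral_set0//.
  by apply/seteqP; split => w // /QK/=; rewrite ltNge uK.
have u0 : 0 < u by lra.
have mQu : measurable [set w | Q (w, u)].
  by apply: measurable_preimage mQ; exact: pair2_measurable.
have r0 w : 0 < 1 + u^-1 * dP w.
  have /andP[? ?] := dPK' w.
  by rewrite -(mulVf (lt0r_neq0 u0)) -mulrDr mulr_gt0 ?invr_gt0//; lra.
transitivity (u%:E * mu [set w | Q (w, u)])%E; last first.
  transitivity (\int[mu]_(w in [set w | Q (w, u)]) cst u%:E w)%E; last by [].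
  by rewrite integral_cst.
rewrite -(time_change_P r0 mQu) -ge0_integralZl_EFin//; last 4 first.
- exact: (measurable_time_change_P _ mQu).
- by move=> w _; rewrite lee_fin ltW.
- apply/measurable_EFinP; apply: measurable_funTS.
  by apply: measurable_funD => //; apply: measurable_funM => //; exact: dP_measurable.
- exact: ltW.
rewrite (_ : [set x | S4 (x, u)] =
    [set w | [set x | Q (x, u)] (translate w (psi (u^-1 * P w)))]); last first.
  by apply/seteqP; split => w; [case|].
apply: eq_integral => w _; rewrite /k3/= -EFinM; congr EFin.
by field; rewrite gt_eqF.
Qed.

(** * Adiabatic invariance *)

(** A tube argument: the difference is jointly continuous in [(w, s)] and vanishes at [s = 0], so
    compactness of [Om] gives one [del] for all [w]. *)
Lemma ddP_unif_continuous (eta : R) : 0 < eta ->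
  exists2 del : R, 0 < del &
    forall w s, `|s| < del -> `|ddP (w + psi s) - ddP w| <= eta.
Proof.
move=> eta0.
pose g (z : Om * R) := ddP (z.1 + psi z.2) - ddP z.1.
have cg : continuous g.
  move=> z; apply: (@cvgB _ _ _ (nbhs z) _ (fun z : Om * R => ddP (z.1 + psi z.2))
    (fun z : Om * R => ddP z.1)).
    by apply: (@continuous_comp _ _ _ (fun z : Om * R => z.1 + psi z.2) ddP);
      [exact: flow_continuous|exact: ddP_continuous].
  by apply: continuous_comp; [exact: cvg_fst|exact: ddP_continuous].
have /compact_near_coveringP cov := cptOm.
have : \forall s \near (0 : R), [set: Om] `<=` (fun w => `|g (w, s)| < eta).
  apply: (cov R (nbhs (0 : R)) (fun s w => `|g (w, s)| < eta)
    (nbhs_filter (0 : R))) => x _.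
  have := cg (x, 0) => /cvgrPdist_lt /(_ eta eta0); apply: filterS => z.
  by rewrite {1}/g/= (psi0 psiD) addr0 subrr sub0r normrN; case: z.
move=> /nbhs_ballP[del /= del0 H]; exists del => // w s sd.
by apply/ltW/H => //; rewrite /ball/= sub0r normrN.
Qed.

Lemma mvt_bound (f df : R -> R) (M s : R) :
  (forall x : R, is_derive x 1 f (df x)) -> f 0 = 0 ->
  (forall x, `|x| <= `|s| -> `|df x| <= M) -> `|f s| <= M * `|s|.
Proof.
move=> fE f0 dfM.
have cf : continuous f.
  by move=> x; apply/differentiable_continuous/derivable1_diffP; case: (fE x).
have [s0|s0|<-] := ltgtP 0 s; last by rewrite f0 !normr0 mulr0.
- have [c cs] := MVT s0 (fun x _ => fE x) (continuous_subspaceT cf).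
  rewrite f0 !subr0 => ->; rewrite normrM ler_wpM2r// dfM//.
  by move: cs; rewrite in_itv/= => /andP[c0 cs]; rewrite !gtr0_norm// ltW.
- have [c cs] := MVT s0 (fun x _ => fE x) (continuous_subspaceT cf).
  rewrite f0 !sub0r -normrN => ->; rewrite normrM normrN ler_wpM2r// dfM//.
  by move: cs; rewrite in_itv/= => /andP[cs c0]; rewrite !ltr0_norm// lerN2 ltW.
Qed.

(** The mean value bound is applied to the derivative of the remainder and then to the remainder
    itself. The lost factor 1/2 is harmless. *)
Lemma P_taylor w s eta : 
  (forall x, `|x| <= `|s| -> `|ddP (w + psi x) - ddP w| <= eta) ->
  `|P (w + psi s) - P w - s * dP w - s ^+ 2 / 2 * ddP w| <= eta * s ^+ 2.
Proof.
move=> H.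
pose g1 (x : R) := dP (w + psi x) - dP w - x * ddP w.
pose g (x : R) := P (w + psi x) - P w - x * dP w - x ^+ 2 / 2 * ddP w.
have lin (c x : R) : is_derive x 1 (fun y : R => y * c) c.
  by apply: is_derive_eq; rewrite ?scaler0 ?add0r ?addr0 [_ *: _]mulr1.
have quad (c x : R) : is_derive x 1 (fun y : R => y ^+ 2 / 2 * c) (x * c).
  apply: is_derive_eq; rewrite /GRing.scale/= ?mulr1 ?mulr0 ?add0r ?addr0.
  by field.
have sub_cst (f : R -> R) (df c x : R) :
    is_derive x 1 f df -> is_derive x 1 (fun y => f y - c) df.
  by move=> fE; rewrite -[df]subr0; exact: is_deriveB.
have subD (f h : R -> R) (df dh x : R) : is_derive x 1 f df ->
    is_derive x 1 h dh -> is_derive x 1 (fun y => f y - h y) (df - dh).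
  by move=> fE hE; exact: is_deriveB.
have g1E (x : R) : is_derive x 1 g1 (ddP (w + psi x) - ddP w).
  have h := sub_cst _ _ (dP w) x (dP_is_derive w x).
  exact: (subD _ _ _ _ x h (lin (ddP w) x)).
have gE (x : R) : is_derive x 1 g (g1 x).
  have h := sub_cst _ _ (P w) x (P_is_derive w x).
  exact: (subD _ _ _ _ x (subD _ _ _ _ x h (lin (dP w) x)) (quad (ddP w) x)).
have g10 : g1 0 = 0 by rewrite /g1 (psi0 psiD) addr0; ring.
have g0 : g 0 = 0 by rewrite /g (psi0 psiD) addr0; ring.
rewrite -/(g s) -(real_normK (num_real s)) expr2 mulrA; apply: (mvt_bound gE g0) => x xs.
apply: le_trans (mvt_bound g1E g10 _) _.
  by move=> y yx; apply: H; exact: le_trans xs.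
by rewrite ler_wpM2l// (le_trans _ (H 0 _))// normr0.
Qed.

Definition adiabatic (z : X * R) : R := P z.1 * z.2.

(** Locates both impacts on the fixed wall relative to the point [th] of the collision between them,
    so that both values of [P] can be expanded at [th]. *)
Lemma bounceE z : vs < z.2 ->
  exists th : Om, let v := z.2 in let u := v - 2 * dP th in
  [/\ z.1 = th + psi (- (P th / v)) :> Om,
      bounce z = (th + psi (P th / u), u) & 0 < u].
Proof.
case: z => w v /= vv; exists (translate w (psi (impact_time (w, v)))).
rewrite /bounce/= vv; split => //; last by have := dP_le_vs (translate w (psi (impact_time (w, v)))); lra.
rewrite /impact_time/= vv /translate -(pp_tildeP w 0 vv) subr0 mulfK; last first.
  by rewrite gt_eqF// (vs_gt0 vv).
by rewrite -addrA -psiD subrr (psi0 psiD) addr0.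
Qed.

(* Expanding around the impact on the moving wall, the terms of order 1 and
   [1 / v] cancel. *)
Lemma adiabatic_le (eps : R) : 0 < eps ->
  exists V : R, forall z, V <= z.2 ->
    vs < z.2 /\ adiabatic (bounce z) <= adiabatic z + eps / z.2.
Proof.
move=> eps0.
have [K K0 dPK] := continuous_bounded dP_continuous.
have [K' K'0 ddPK] := continuous_bounded ddP_continuous.
have b0 := b_gt0.
(* The two Taylor remainders add up to at most [eta * b ^+ 2 * (2 / v + 1 / v)], which is half of
   [eps / v]. *)
have [|del del0 Hdel] := @ddP_unif_continuous (eps / (6 * b ^+ 2)).
  by rewrite divr_gt0// mulr_gt0// exprn_gt0.
set eta := eps / _ in Hdel.
(* The term [4 * K] gives [v / 2 <= u], the term with [eps] bounds the second-order difference by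
   [eps / (2 * v)], and [4 * b / del] keeps both flight times below [del]. *)
exists (vs + 1 + 4 * K + 4 * b ^+ 2 * K * K' / eps + 4 * b / del) => -[w v] /= Vv.
have vs0 := vs_ge0.
have h1 : 0 <= 4 * b ^+ 2 * K * K' / eps.
  by rewrite divr_ge0 ?mulr_ge0 ?exprn_ge0 ?ltW.
have h2 : 0 < 4 * b / del by rewrite divr_gt0// mulr_gt0.
have vv : vs < v by lra.
split=> //.
have [th /= [wE bE u0]] := @bounceE (w, v) vv.
rewrite /adiabatic bE/= wE.
set p := P th in wE bE *; set d := dP th in bE u0 *; set u := v - 2 * d in bE u0 *.
have v0 := vs_gt0 vv.
have dK : - K <= d <= K by rewrite -ler_norml dPK.
have p0 : 0 < p by exact: P_gt0.
have pb : p <= b by exact: P_leb.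
have uv : v / 2 <= u by move: dK => /andP[? ?]; rewrite /u; lra.
have bdel : 4 * b < v * del.
  by rewrite -ltr_pdivrMr//; lra.
have pu : `|p / u| < del.
  rewrite ger0_norm ?divr_ge0 ?ltW// ltr_pdivrMr//.
  have : v / 2 * del <= u * del by rewrite ler_wpM2r// ltW.
  by lra.
have pv : `|- (p / v)| < del.
  by rewrite normrN ger0_norm ?divr_ge0 ?ltW// ltr_pdivrMr//; lra.
have T1 := @P_taylor th (p / u) eta (fun x hx => Hdel th x (le_lt_trans hx pu)).
have T0 := @P_taylor th (- (p / v)) eta (fun x hx => Hdel th x (le_lt_trans hx pv)).
move: T1 T0; rewrite -/p -/d; set e := ddP th.
set P1 := P (th + psi (p / u)); set P0 := P (th + psi (- (p / v))) => T1 T0.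
have edK : e * d <= K' * K.
  rewrite (le_trans (ler_norm _))// normrM ler_pM//; [exact: ddPK|exact: dPK].
have u_neq0 : u != 0 by rewrite gt_eqF.
have v_neq0 : v != 0 by rewrite gt_eqF.
have iu0 : 0 < u^-1 by rewrite invr_gt0.
have iv0 : 0 < v^-1 by rewrite invr_gt0.
have iuv : u^-1 <= 2 * v^-1.
  by rewrite ler_pdivlMr// mulrC ler_pdivrMr//; lra.
have pp : p ^+ 2 <= b ^+ 2 by rewrite !expr2 ler_pM ?(ltW p0).
have eta0 : 0 < eta by rewrite divr_gt0// mulr_gt0// exprn_gt0.
have q1 : P1 * u <= p * u + p * d + p ^+ 2 * e / 2 * u^-1 + eta * p ^+ 2 * u^-1.
  have : (P1 - p - p / u * d - (p / u) ^+ 2 / 2 * e) * u <=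
      eta * (p / u) ^+ 2 * u.
    by rewrite ler_wpM2r ?(ltW u0)// (le_trans (ler_norm _)).
  have -> : (P1 - p - p / u * d - (p / u) ^+ 2 / 2 * e) * u =
      P1 * u - (p * u + p * d + p ^+ 2 * e / 2 * u^-1) by field.
  have -> : eta * (p / u) ^+ 2 * u = eta * p ^+ 2 * u^-1 by field.
  by lra.
have q0 : p * v - p * d + p ^+ 2 * e / 2 * v^-1 - eta * p ^+ 2 * v^-1 <= P0 * v.
  move: T0; rewrite ler_norml => /andP[T0 _].
  have : - (eta * (- (p / v)) ^+ 2) * v <=
      (P0 - p - - (p / v) * d - (- (p / v)) ^+ 2 / 2 * e) * v.
    by rewrite ler_wpM2r ?(ltW v0).
  have -> : (P0 - p - - (p / v) * d - (- (p / v)) ^+ 2 / 2 * e) * v =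
      P0 * v - (p * v - p * d + p ^+ 2 * e / 2 * v^-1) by field.
  have -> : - (eta * (- (p / v)) ^+ 2) * v = - (eta * p ^+ 2 * v^-1) by field.
  by lra.
(* Since [u^-1 - v^-1 = 2 * d * (u^-1 * v^-1)], the second-order terms differ only at order
   [v ^- 2]. *)
have q2 : p ^+ 2 * e / 2 * u^-1 - p ^+ 2 * e / 2 * v^-1 =
    p ^+ 2 * (e * d) * (u^-1 * v^-1).
  by move: u_neq0; rewrite /u => un; field; rewrite v_neq0 un.
have q3 : p ^+ 2 * (e * d) * (u^-1 * v^-1) <= eps / 2 * v^-1.
  have KK : 0 <= K' * K by rewrite mulr_ge0// ltW.
  apply: (@le_trans _ _ (b ^+ 2 * (K' * K) * (2 * v^-1 * v^-1))).
    apply: (@le_trans _ _ (b ^+ 2 * (K' * K) * (u^-1 * v^-1))).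
      rewrite ler_wpM2r ?mulr_ge0 ?(ltW iu0) ?(ltW iv0)//.
      apply: (@le_trans _ _ (p ^+ 2 * (K' * K))).
        by rewrite ler_wpM2l// exprn_ge0// ltW.
      by rewrite ler_wpM2r.
    apply: ler_wpM2l; first by rewrite mulr_ge0// exprn_ge0// ltW.
    by rewrite ler_wpM2r// ltW.
  have bK : b ^+ 2 * (K' * K) * 4 <= v * eps.
    rewrite -ler_pdivrMr//; apply: le_trans _ (_ : 4 * b ^+ 2 * K * K' / eps <= v).
      by rewrite le_eqVlt; apply/orP; left; apply/eqP; field; rewrite gt_eqF.
    by lra.
  have -> : b ^+ 2 * (K' * K) * (2 * v^-1 * v^-1) =
      (b ^+ 2 * (K' * K) * 4) * (v^-1 * v^-1 / 2) by field.
  have -> : eps / 2 * v^-1 = (v * eps) * (v^-1 * v^-1 / 2) by field.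
  by rewrite ler_wpM2r// divr_ge0 ?mulr_ge0 ?ltW.
have q4 : eta * p ^+ 2 * u^-1 + eta * p ^+ 2 * v^-1 <= eps / 2 * v^-1.
  have -> : eps / 2 * v^-1 = eta * b ^+ 2 * (2 * v^-1 + v^-1).
    by rewrite /eta; field; rewrite v_neq0 gt_eqF.
  rewrite -mulrDr; apply: ler_pM.
  - by rewrite mulr_ge0 ?exprn_ge0// ltW.
  - by rewrite addr_ge0// ltW.
  - by rewrite ler_wpM2l// ltW.
  - by rewrite lerD2r.
have q5 : p * u + p * d = p * v - p * d by rewrite /u; ring.
have : eps / v = eps / 2 * v^-1 + eps / 2 * v^-1 by field.
lra.
Qed.

(** * Escaping orbits *)

(** Each velocity section has length at most [l] and weight at most [H], and [mu] has mass 1. It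
    gives both a crude finiteness bound and the smallness of a thin strip below a level. *)
Lemma strip_integral_le (S : set (X * R)) (p : X -> R) (H l : R) :
  measurable S -> 0 <= H -> 0 <= l ->
  (forall w v, S (w, v) -> 0 <= v <= H /\ p w <= v <= p w + l) ->
  (\int[mu \x leb]_(z in S) z.2%:E <= (H * l)%:E)%E.
Proof.
move=> mS H0 l0 SH.
have mk : measurable_fun S (fun z : X * R => z.2%:E).
  by apply/measurable_EFinP; exact: measurable_funTS.
have k0 (z : X * R) : S z -> (0 <= z.2%:E)%E.
  by case: z => w v /SH[/andP[v0 _] _]; rewrite lee_fin.
have -> : (\int[mu \x leb]_(z in S) z.2%:E =
    \int[mu]_w \int[leb]_(v in [set v | S (w, v)]) v%:E)%E.
  exact: (tonelli_set1 mu leb mS mk k0).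
apply: (@le_trans _ _ (\int[mu]_w cst (H * l)%:E w)%E); last first.
  have -> : (\int[mu]_w cst (H * l)%:E w = (H * l)%:E * mu setT)%E.
    exact: integral_cst.
  by rewrite probability_setT mule1.
apply: ge0_le_integral => //.
- by move=> w _; apply: integral_ge0 => v; exact: (k0 (w, v)).
- exact: (measurable_tonelli_set1 leb mS mk k0).
move=> w _.
have mSw : measurable [set v | S (w, v)].
  by apply: measurable_preimage mS; exact: pair1_measurable.
apply: (@le_trans _ _ (\int[leb]_(v in [set v | S (w, v)]) cst H%:E v)%E).
  apply: ge0_le_integral => //.
  - by move=> v; exact: (k0 (w, v)).
  - by move=> v /= /SH[/andP[_ vH] _]; rewrite lee_fin.
rewrite integral_cst// EFinM lee_wpmul2l ?lee_fin//.
apply: (@le_trans _ _ (leb `[p w, p w + l])).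
  apply: subset_lebesgue_measure => //.
  by move=> v /= /SH[_ ?]; rewrite in_itv.
rewrite lebesgue_measure_itv/= lte_fin; case: ifP => _.
  by rewrite -EFinB addrAC subrr add0r.
by rewrite lee_fin.
Qed.

Lemma adiabatic_measurable : measurable_fun setT adiabatic.
Proof. exact: (measurable_funM mP1 measurable_snd). Qed.

Lemma iter_bounce_measurable n : measurable_fun setT (iter n bounce).
Proof.
elim: n => [|n ih]; first exact: measurable_id.
exact: (@measurableT_comp _ _ _ _ _ _ _ _ _ bounce_measurable ih).
Qed.

Let adiabatic_iter_measurable n :
  measurable_fun setT (fun z => adiabatic (iter n bounce z)).
Proof.
exact: (@measurableT_comp _ _ _ _ _ _ _ _ _ adiabatic_measurable (iter_bounce_measurable n)).
Qed.

Definition last_crossing (c : R) : set (X * R) :=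
  [set z | adiabatic z < c /\ forall n, c <= adiabatic (iter n.+1 bounce z)].

Lemma measurable_above (c : R) (N : nat) :
  measurable [set z | forall n, c <= adiabatic (iter (N + n) bounce z)].
Proof.
rewrite (_ : [set z | _] =
    \bigcap_n [set z | c <= adiabatic (iter (N + n) bounce z)]); last first.
  by apply/seteqP; split => z h n; [move=> _; exact: h|exact: h].
by apply: bigcapT_measurable => n; exact: measurable_set_ler.
Qed.

Lemma measurable_last_crossing c : measurable (last_crossing c).
Proof.
apply: measurableI; first exact: (measurable_set_ltr (adiabatic_iter_measurable 0)).
exact: (measurable_above c 1).
Qed.

Lemma adiabatic_ge_speed (c : R) z : 0 < c -> c <= adiabatic z -> c / b <= z.2.
Proof.
move=> c0 cz; have b0 := b_gt0; have P0 := P_gt0 z.1.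
have z0 : 0 < z.2 by rewrite -(pmulr_rgt0 _ P0); exact: lt_le_trans cz.
rewrite ler_pdivrMr// (le_trans cz)// /adiabatic mulrC ler_wpM2l ?P_leb//.
exact: ltW.
Qed.

(** A slow state is fixed by [bounce] and cannot cross. Otherwise the velocity after the bounce is
    at least [c / b], and one bounce changes it by at most [2 * K]. *)
Lemma crossing_speed (K c : R) z : (forall w, `|dP w| <= K) -> 0 < c ->
  adiabatic z < c -> c <= adiabatic (bounce z) ->
  vs < z.2 /\ c / b - 2 * K <= z.2.
Proof.
move=> dPK c0 zc cz.
have [vz|zv] := ltP vs z.2; last first.
  by move: cz; rewrite /bounce ltNge zv/= leNgt zc.
split => //; have := adiabatic_ge_speed c0 cz.
have [th /= [_ -> _]] := bounceE vz => /=.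
by have := dPK th; rewrite ler_norml => /andP[? ?]; lra.
Qed.

(* Flux balance for [Q], the states staying above [c] and currently below [c']:
   [bounce] maps both [last_crossing c] and the part [Q1] of [Q] still below [c']
   after one bounce into [Q]. *)
Lemma last_crossing_integral_le :
  exists2 c0 : R, 0 < c0 & forall c, c0 <= c -> forall eps, 0 < eps ->
  (\int[mu \x leb]_(z in last_crossing c) z.2%:E <= (2 * b * eps / a ^+ 2)%:E)%E.
Proof.
have b0 := b_gt0.
have [K K0 dPK] := continuous_bounded dP_continuous.
have [V1 HV1] := adiabatic_le ltr01.
have vs0 := vs_ge0.
have V10 := normr_ge0 V1; have V1n := ler_norm V1.
(* States crossing [c] have velocity at least [c / b - 2 * K], hence above [V1] and at least 1;
   states above [c] are faster than both [K] and [vs]. *)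
exists (b * (`|V1| + vs + 3 * K + 1)); first by rewrite mulr_gt0//; lra.
move=> c c0c eps eps0.
have cb : `|V1| + vs + 3 * K + 1 <= c / b by rewrite ler_pdivlMr// mulrC.
have c_gt0 : 0 < c by apply: lt_le_trans c0c; rewrite mulr_gt0//; lra.
have [Ve HVe] := adiabatic_le eps0.
have Ve0 := normr_ge0 Ve; have Ven := ler_norm Ve.
(* States in [last_crossing c] gain at most 1 in one bounce, so they land below [c']. The last term
   makes a state that crosses [c'] faster than both [Ve] and [c' / (2 * b)]. *)
pose c' := c + 2 + b * (`|Ve| + 6 * K).
have bVe : 0 <= b * (`|Ve| + 6 * K) by rewrite mulr_ge0 ?ltW//; lra.
have cc' : c + 1 < c' by rewrite /c'; lra.
have c'0 : 0 < c' by lra.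
have c'b : `|Ve| + 6 * K <= c' / b by rewrite ler_pdivlMr// mulrC /c'; lra.
pose Q : set (X * R) :=
  [set z | (forall n, c <= adiabatic (iter n bounce z)) /\ adiabatic z < c'].
pose Q1 := Q `&` [set z | adiabatic (bounce z) < c'].
pose Q2 := Q `&` [set z | c' <= adiabatic (bounce z)].
have mQ : measurable Q.
  apply: measurableI; first exact: (measurable_above c 0).
  exact: (measurable_set_ltr (adiabatic_iter_measurable 0)).
have mQ1 : measurable Q1.
  by apply: measurableI => //; exact: (measurable_set_ltr (adiabatic_iter_measurable 1)).
have mQ2 : measurable Q2.
  apply: measurableI => //.
  exact: (measurable_set_ler _ (adiabatic_iter_measurable 1)).
have mA := measurable_last_crossing c.
have QK z : Q z -> K < z.2 /\ vs < z.2.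
  by move=> [/(_ 0%N)/= /(adiabatic_ge_speed c_gt0) h _]; split; lra.
have AK z : last_crossing c z -> vs < z.2 /\ adiabatic (bounce z) < c'.
  move=> [zc cz]; have [vz h] := crossing_speed dPK c_gt0 zc (cz 0%N).
  split => //; have [|_] := HV1 z; first lra.
  have : 1 / z.2 <= 1 by rewrite ler_pdivrMr ?(vs_gt0 vz)// mul1r; lra.
  by lra.
have z0 z : last_crossing c z \/ Q z -> (0 <= z.2%:E)%E.
  by rewrite lee_fin => -[/AK[/vs_gt0/ltW]|/QK[]]//; lra.
have mz (S : set (X * R)) : measurable_fun S (fun z : X * R => z.2%:E).
  by apply/measurable_EFinP; exact: measurable_funTS.
have sub : last_crossing c `|` Q1 `<=` bounce_preimage Q.
  move=> z [Az|[Qz zc']].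
    have [vz zc'] := AK _ Az; split => //; split => // n.
    by case: Az => _ /(_ n); rewrite iterSr.
  have [_ vz] := QK _ Qz; split => //; split => // n.
  by case: Qz => /(_ n.+1); rewrite iterSr.
have Q12 : Q = Q1 `|` Q2.
  rewrite -setIUr; apply/esym/setIidPl => z _ /=.
  by have [|] := ltP (adiabatic (bounce z)) c'; [left|right].
have speed z : Q z -> z.2 < c' / P z.1 /\ z.2 < c' / a.
  move=> Qz; have [Kz vz] := QK _ Qz; case: Qz => _; rewrite /adiabatic => h.
  split; first by rewrite ltr_pdivlMr ?P_gt0// mulrC.
  rewrite ltr_pdivlMr//; apply: le_lt_trans h; rewrite mulrC ler_wpM2r ?P_gea//.
  by rewrite ltW// (vs_gt0 vz).
(* Finiteness allows the mass of [Q1] to be cancelled from both sides of the flux balance. *)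
have Q1fin : (\int[mu \x leb]_(z in Q1) z.2%:E)%E \is a fin_num.
  rewrite ge0_fin_numE; last by apply: integral_ge0 => z [Qz _]; apply: z0; right.
  apply: (@le_lt_trans _ _ ((c' / a) * (c' / a))%:E); last by rewrite ltey.
  apply: (@strip_integral_le Q1 (cst 0)) => //.
  - by rewrite divr_ge0// ltW.
  - by rewrite divr_ge0// ltW.
  - move=> w v [Qz _]; have [_ /= h] := speed _ Qz; have [_ /= /vs_gt0 h'] := QK _ Qz.
    by rewrite add0r !(ltW h') (ltW h).
have AQ : (\int[mu \x leb]_(z in last_crossing c) z.2%:E +
    \int[mu \x leb]_(z in Q1) z.2%:E <=
    \int[mu \x leb]_(z in Q2) z.2%:E + \int[mu \x leb]_(z in Q1) z.2%:E)%E.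
  rewrite -ge0_integral_setU//; last 3 first.
  - exact: mz.
  - by move=> z [?|[? _]]; apply: z0; [left|right].
  - apply/disj_setPS => z [[zc _] [[/(_ 0%N)/= cz _] _]].
    by move: zc; rewrite ltNge cz.
  apply: (@le_trans _ _ (\int[mu \x leb]_(z in bounce_preimage Q) z.2%:E)%E).
    apply: ge0_subset_integral => //.
    - exact: measurableU.
    - exact: measurable_bounce_preimage.
    - exact: mz.
    - by move=> z [/vs_gt0/ltW ? _]; rewrite lee_fin.
  apply: (@le_trans _ _ (\int[mu \x leb]_(z in Q) z.2%:E)%E).
    by apply: (bounce_subinvariant dPK) => // z /QK[].
  rewrite {1}Q12 ge0_integral_setU//; last 3 first.
  - exact: mz.
  - by move=> z [[? _]|[? _]]; apply: z0; right.
  - apply/disj_setPS => z [[_ /= zc] [_ /=]]; rewrite leNgt zc//.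
  by rewrite addeC.
rewrite leeD2rE// in AQ.
apply: (le_trans AQ).
(* Velocity bound times strip width: the jump is at most [eps / v <= 2 * b * eps / c'], and dividing
   by [P] gives the width. The factor [c'] cancels, so the bound does not depend on the auxiliary
   level. *)
have -> : 2 * b * eps / a ^+ 2 = c' / a * (2 * b * eps / (c' * a)).
  by field; rewrite !gt_eqF.
apply: (@strip_integral_le Q2 (fun w => (c' - 2 * b * eps / c') / P w)) => //.
- by rewrite divr_ge0// ltW.
- by rewrite divr_ge0 ?mulr_ge0 ?ltW.
- move=> w v [Qz /= c'z].
  have [/= h h'] := speed _ Qz; have [_ /= /vs_gt0 v0] := QK _ Qz.
  split; first by rewrite !ltW.
  have P0 := P_gt0 w.
  have [_ /= vc'] := crossing_speed dPK c'0 (proj2 Qz) c'z.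
  have [|_ /= Hz] := HVe (w, v); first by rewrite /=; lra.
  have ev : eps / v <= 2 * b * eps / c'.
    rewrite ler_pdivrMr// mulrAC ler_pdivlMr// [X in _ <= X]mulrC mulrA.
    rewrite [X in _ <= X](_ : _ = eps * (v * (2 * b))); last by ring.
    rewrite ler_wpM2l ?ltW//.
    have := c'b; rewrite ler_pdivlMr// => h1.
    have : (c' / b - 2 * K) * b <= v * b by rewrite ler_wpM2r// ltW.
    by rewrite mulrBl divfK ?gt_eqF//; have : 0 <= `|Ve| * b; [rewrite mulr_ge0// ltW|lra].
  apply/andP; split.
    rewrite ler_pdivrMr// mulrC; move: c'z Hz; rewrite /adiabatic/= => ? ?; lra.
  apply: (le_trans (ltW h)).
  have eP : 2 * b * eps / c' / P w <= 2 * b * eps / (c' * a).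
    rewrite invfM mulrA; apply: ler_wpM2l.
      by rewrite divr_ge0 ?mulr_ge0 ?ltW.
    by rewrite lef_pV2 ?posrE ?P_gea.
  by rewrite mulrBl; lra.
Qed.

Lemma last_crossing_null :
  exists2 c0 : R, 0 < c0 &
    forall c, c0 <= c -> (mu \x leb)%E (last_crossing c) = 0%E.
Proof.
have [c0 c00 H] := last_crossing_integral_le; exists c0 => // c cc.
have b0 := b_gt0.
have [K K0 dPK] := continuous_bounded dP_continuous.
apply: (@integral0_gt0_null _ _ _ (mu \x leb)%E _ (fun z => z.2%:E)).
- exact: measurable_last_crossing.
- by apply/measurable_EFinP; exact: measurable_funTS.
- move=> z [zc cz]; have [/vs_gt0 + _] := crossing_speed dPK (lt_le_trans c00 cc) zc (cz 0%N).
  by rewrite lte_fin.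
apply/eqP; rewrite eq_le; apply/andP; split.
  apply/lee_addgt0Pr => e e0; rewrite add0e.
  apply: le_trans (H c cc (e * a ^+ 2 / (2 * b)) _) _.
    by rewrite divr_gt0// mulr_gt0// exprn_gt0.
  rewrite lee_fin le_eqVlt; apply/orP; left; apply/eqP.
  by field; rewrite !gt_eqF.
apply: integral_ge0 => z [zc cz].
have [/vs_gt0 + _] := crossing_speed dPK (lt_le_trans c00 cc) zc (cz 0%N).
by move=> /ltW; rewrite lee_fin.
Qed.

(** The levels [c0 + m] form a countable family exceeding every initial value of [adiabatic]. [N]
    collects the states that reach a last crossing of one of them after finitely many bounces, and
    [bounce_null] keeps each iterated preimage null. *)
Lemma escaping_sub_null : exists N : set (X * R),
  [/\ measurable N, (mu \x leb)%E N = 0%E &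
    forall (w : Om) t v,
      escaping_set (fun s => P (w + psi s)) vs (t, v) -> N (w + psi t, v)].
Proof.
have [c0 c00 lc0] := last_crossing_null.
pose A0 : set (X * R) := \bigcup_m last_crossing (c0 + m%:R).
pose A n := iter n bounce_preimage A0.
have mA n : measurable (A n).
  elim: n => [|n ih]; last exact: measurable_bounce_preimage.
  by apply: bigcupT_measurable => m; exact: measurable_last_crossing.
have nA n : (mu \x leb)%E (A n) = 0%E.
  elim: n => [|n ih]; last exact: bounce_null.
  apply: (bigcup_null (m := (mu \x leb)%E)) => m.
    exact: measurable_last_crossing.
  by apply: lc0; rewrite lerDl.
exists (\bigcup_n A n); split.
- exact: bigcupT_measurable.
- exact: (bigcup_null (m := (mu \x leb)%E)).
move=> w t v [esc cvg_v].
pose z : X * R := (w + psi t, v).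
have zE n : iter n bounce z = (w + psi (pp_orbit (fun s => P (w + psi s)) (t, v) n).1,
    (pp_orbit (fun s => P (w + psi s)) (t, v) n).2).
  by apply: bounce_iter => k _; exact: esc.
have vz n : vs < (iter n bounce z).2 by rewrite zE; exact: esc.
have inA n : A0 (iter n bounce z) -> A n z.
  have : forall y, (forall k, vs < (iter k bounce y).2) ->
      A0 (iter n bounce y) -> A n y.
    elim: n => [//|n ih] y vy Ay; split; first exact: (vy 0%N).
    apply: ih => [k|]; last by rewrite -iterSr.
    by rewrite -iterSr.
  by apply.
pose m := (Num.truncn `|adiabatic z|).+1.
pose c := c0 + m%:R.
have zc : adiabatic z < c.
  apply: le_lt_trans (ler_norm _) _.
  by apply: lt_trans (truncnS_gt _) _; rewrite ltrDr.
(* As [P >= a], velocities above [c / a] put the orbit above the level [c]. *)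
have [N HN] : exists N, forall n, (N <= n)%N -> c <= adiabatic (iter n bounce z).
  have /cvgryPge/(_ (c / a)) [N _ HN] := cvg_v.
  exists N => n Nn; have := HN n Nn; rewrite /= => h.
  rewrite /adiabatic zE/=.
  rewrite ler_pdivrMr// mulrC in h; apply: le_trans h _.
  rewrite ler_wpM2r ?P_gea//.
  by have := vz n; rewrite zE => /vs_gt0/ltW.
(* The last time below [c], found by descending from [N]; the descent stops because the orbit starts
   below [c]. *)
have [n [nc Hn]] : exists n, adiabatic (iter n bounce z) < c /\
    forall k, c <= adiabatic (iter k.+1 bounce (iter n bounce z)).
  elim: N HN => [/(_ 0%N isT)|N ih HN]; first by rewrite leNgt zc.
  have [h|h] := ltP (adiabatic (iter N bounce z)) c.
    by exists N; split => // k; rewrite -iterD; apply: HN; rewrite addSn ltnS leq_addl.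
  apply: ih => n; rewrite leq_eqVlt => /predU1P[<-//|]; exact: HN.
exists n => //; apply: inA; exists m => //.
Qed.

End pingpong.

(** * Haar measure as a probability, and the conclusion *)

Section probability_of_measure.
Context {R : realType} {Om : topologicalZmodType}.
Variable mu : {measure set (borel_type Om) -> \bar R}.
Hypothesis muT : mu setT = 1%E.

(** A separate name for [mu], to which the probability structure given by [muT] can be attached. *)
Definition normalized_measure : set (borel_type Om) -> \bar R := mu.
HB.instance Definition _ := Measure.on normalized_measure.
HB.instance Definition _ :=
  @Measure_isProbability.Build _ _ R normalized_measure muT.

Definition probability_of_measure : probability (borel_type Om) R :=
  normalized_measure.

End probability_of_measure.

Unset Implicit Arguments.

Theorem theorem5p1 (R : realType) (Om : topologicalZmodType)
  (psi : R -> Om) (mu : {measure set (borel_type Om) -> \bar R})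
  (a b : R) (P : Om -> R) :
  metrizable R Om ->
  compact [set: Om] ->
  continuous psi ->
  (forall s t, psi (s + t) = psi s + psi t) ->
  dense (range psi) ->
  haar_probability mu ->
  0 < a -> a < b ->
  C2psi psi P ->
  (forall w, a <= P w <= b) ->
  let vstar := 2 * Num.max (sup (range (dpsi psi P))) 0 in
  {ae mu, forall w : borel_type Om,
     (@lebesgue_measure R \x @lebesgue_measure R)%E.-negligible
       (escaping_set (fun t => P ((w : Om) + psi t)) vstar)}.
Proof.
move=> _ cptOm cpsi psiD _ [muT mu_trans] a_gt0 _ PC2 Pab vstar.
pose m := probability_of_measure muT.
have [N [mN N0 escN]] :=
  @escaping_sub_null R Om psi m a b P cptOm cpsi psiD mu_trans a_gt0 PC2 Pab.
have := flow_null_plane cpsi (mu := m) mu_trans mN N0.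
apply: filterS => w Nw0.
(* The measurable null cover is the trace of [N] along the orbit of [w]. *)
exists [set z : R * R | N (translate w (psi z.1), z.2)]; split.
- apply: (@measurable_preimage _ _ _ _
    (fun z : R * R => (translate w (psi z.1), z.2))) => //.
  apply: measurable_fun_pair => //.
  apply: (@measurableT_comp _ _ _ _ _ _
    (fun z : borel_type Om * R => translate z.1 (psi z.2)) _
    (fun z : R * R => (w, z.1))); first exact: flow_measurable.
  exact: measurable_fun_pair.
- exact: Nw0.
- by move=> [t v] /escN.
Qed.
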